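(* Let $L$ be a locally compact Hausdorff space and $X=C_0(L)$. Then the following are equivalent. (a) $L$ has no isolated point. (b) No point in $\mathrm{ext}(B_{X^*})$ is a point of continuity of $I:(B_{X^*},w^* )\to (B_{X^*},w)$. (c) No point in $S_{X^*}$ is a point of continuity of $I:(B_{X^*},w^* )\to (B_{X^*},w)$. (d) No nonzero $M$-ideal of $X$ is weakly Hahn-Banach smooth. (e) No nonzero subspace of $X$ has property-$(wU)$ in $X^{**}$. (f) No $1$-dimensional subspace of $X$ has property-$(wU)$ in $X^{**}$.
   Context: Scalars are real. $C_0(L)$ is the Banach space of real continuous functions on $L$ vanishing at infinity, with the sup norm. $B_{X^*}$, $S_{X^*}$ are the closed unit ball and unit sphere of $X^*$, $\mathrm{ext}(B_{X^*})$ is the set of extreme points of $B_{X^*}$, $I$ is the identity map, and $w^*$, $w$ are the (relative) weak-$*$ and weak topologies. A point of continuity of $I$ is a point of $B_{X^*}$ at which $I$ is continuous. $X$ is viewed inside $X^{**}$ via the canonical embedding. A subspace $Y$ of a Banach space $Z$ has property-$(wU)$ in $Z$ if every bounded linear functional on $Y$ which attains its norm (on the closed unit ball of $Y$) has a unique norm-preserving linear extension to $Z$. A Banach space is weakly Hahn-Banach smooth if it has property-$(wU)$ in its bidual under the canonical embedding. A closed subspace $J$ of $Z$ is an $M$-ideal if $Z^*=J^\perp\oplus_{\ell_1}W$ for some subspace $W$ of $Z^*$ (direct sum with $\|u+v\|=\|u\|+\|v\|$ for $u\in J^\perp, v\in W$), where $J^\perp$ is the annihilator of $J$. *)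

(* Defs.v *)
From HB Require Import structures.
From mathcomp Require Import all_boot all_order all_algebra.
From mathcomp Require Import all_classical all_reals all_analysis.

Set Implicit Arguments.
Unset Strict Implicit.
Unset Printing Implicit Defensive.

Import Order.TTheory GRing.Theory Num.Theory.
Import numFieldNormedType.Exports.

Local Open Scope classical_set_scope.
Local Open Scope ring_scope.

Section SubNormed.
Context {R : realType} {V : normedModType R}.
Implicit Type Y : submodClosed V.

Definition sub_normed Y : Type := {x : V | x \in Y}.

HB.instance Definition _ Y := SubChoice.on (sub_normed Y).
HB.instance Definition _ Y :=
  [SubChoice_isSubLmodule of sub_normed Y by <:].

Section norm.
Context {Y : submodClosed V}.

Definition sub_norm (x : sub_normed Y) : R := `|val x|.

Lemma sub_normD x y : sub_norm (x + y) <= sub_norm x + sub_norm y.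
Proof. by rewrite /sub_norm raddfD; exact: ler_normD. Qed.

Lemma sub_normZ a x : sub_norm (a *: x) = `|a| * sub_norm x.
Proof. by rewrite /sub_norm linearZ/= normrZ. Qed.

Lemma sub_norm0_eq0 x : sub_norm x = 0 -> x = 0.
Proof. by move=> /normr0_eq0 x0; apply: val_inj; rewrite x0 raddf0. Qed.

HB.instance Definition _ :=
  Lmodule_isNormed.Build R (sub_normed Y) sub_normD sub_normZ sub_norm0_eq0.

End norm.

Definition nonzero_subspace Y := exists2 v, v \in Y & v != 0.

Definition one_dimensional Y :=
  exists2 v, v != 0 & forall x, x \in Y <-> exists a : R, x = a *: v.

Definition whole_space : {pred V} := predT.

Lemma whole_space_submod : subsemimod_closed whole_space.
Proof. by split=> //; split. Qed.

HB.instance Definition _ :=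
  GRing.isSubmodClosed.Build R V whole_space whole_space_submod.

Definition unit_ball : set V := [set x | `|x| <= 1].
Definition unit_sphere : set V := [set x | `|x| = 1].

Definition extreme_points (A : set V) : set V :=
  [set x | A x /\ forall y z (t : R), A y -> A z -> 0 < t < 1 ->
             x = t *: y + (1 - t) *: z -> y = x /\ z = x].

End SubNormed.

Section Dual.
Context {R : realType} (V : normedModType R).

Definition dual_pred : {pred V -> R^o} :=
  [pred f : V -> R^o | `[< scalar f /\ continuous f >]].

Definition dual : Type := {f : V -> R^o | f \in dual_pred}.

Lemma dual_pred_submod : subsemimod_closed dual_pred.
Proof.
split; first split.
- apply/asboolP; split; last by move=> x; exact: cst_continuous.
  by move=> a u v /=; rewrite mulr0 addr0.
- move=> f g /asboolP[lf cf] /asboolP[lg cg]; apply/asboolP; split.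
    have E x : (f + g) x = f x + g x by [].
    by move=> a u v; rewrite !E lf lg mulrDr addrACA.
  by move=> x; apply: continuousD; [exact: cf|exact: cg].
- move=> a f /asboolP[lf cf]; apply/asboolP; split.
    have E x : (a *: f) x = a * f x by [].
    by move=> b u v; rewrite !E lf mulrDr mulrCA.
  by move=> x; apply: (@cvgM _ _ (nbhs x) _ (fun=> a) f);
      [exact: cvg_cst|exact: cf].
Qed.

HB.instance Definition _ :=
  GRing.isSubmodClosed.Build R (V -> R^o) dual_pred dual_pred_submod.
HB.instance Definition _ := SubChoice.on dual.
HB.instance Definition _ := [SubChoice_isSubLmodule of dual by <:].

Definition dual_fun (f : dual) : V -> R := val f.
Coercion dual_fun : dual >-> Funclass.

Definition dual_norm (f : dual) : R := sup [set `|f x| | x in unit_ball].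

Lemma dualD (f g : dual) x : (f + g : dual) x = f x + g x.
Proof. by []. Qed.

Lemma dualZ a (f : dual) x : (a *: f : dual) x = a * f x.
Proof. by []. Qed.

Lemma dual_scalar (f : dual) : scalar f.
Proof. by have /asboolP[] := valP f. Qed.

Lemma dual0r (f : dual) : f 0 = 0.
Proof.
by have := dual_scalar f (-1) 0 0; rewrite scaler0 addr0 mulN1r addNr.
Qed.

Lemma dual_continuous (f : dual) : continuous f.
Proof. by have /asboolP[] := valP f. Qed.

Lemma dual_has_sup (f : dual) : has_sup [set `|f x| | x in unit_ball].
Proof.
split; first by exists `|f 0|, 0 => //=; rewrite /unit_ball/= normr0.
pose lf : {linear V -> R^o} :=
  HB.pack (f : V -> R^o) (GRing.isLinear.Build R V R^o _ f (@dual_scalar f)).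
have /bounded_funP/(_ 1)[M fM] : bounded_near lf (nbhs (0 : V)).
  by apply/linear_bounded_continuous; exact: dual_continuous.
by exists M => _ [x x1 <-]; exact: fM.
Qed.

Lemma dual_norm_ub (f : dual) x : `|x| <= 1 -> `|f x| <= dual_norm f.
Proof. by move=> x1; apply: (sup_upper_bound (dual_has_sup f)); exists x. Qed.

Lemma dual_norm_le (f : dual) M :
  (forall x, `|x| <= 1 -> `|f x| <= M) -> dual_norm f <= M.
Proof.
move=> fM; apply: ge_sup; first by have [] := dual_has_sup f.
by move=> _ [x x1 <-]; exact: fM.
Qed.

Lemma dual_normD f g : dual_norm (f + g) <= dual_norm f + dual_norm g.
Proof.
apply: dual_norm_le => x x1; rewrite dualD (le_trans (ler_normD _ _))//.
by rewrite lerD// dual_norm_ub.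
Qed.

Lemma dual_normZ a f : dual_norm (a *: f) = `|a| * dual_norm f.
Proof.
have le b g : dual_norm (b *: g) <= `|b| * dual_norm g.
  apply: dual_norm_le => x x1.
  by rewrite dualZ normrM ler_wpM2l// dual_norm_ub.
apply/le_anti; rewrite le/=.
have [->|a0] := eqVneq a 0.
  rewrite normr0 mul0r (le_trans (normr_ge0 ((0 *: f : dual) 0)))//.
  by rewrite dual_norm_ub// normr0.
rewrite -ler_pdivlMl ?normr_gt0// -normfV -{1}[f]scale1r -(mulVf a0) -scalerA.
exact: le.
Qed.

Lemma dual_norm0_eq0 f : dual_norm f = 0 -> f = 0.
Proof.
move=> f0; apply/val_inj/funext => x /=.
have [->|x0] := eqVneq x 0.
  by rewrite -[LHS]/(f 0) dual0r.
have nx : `|x| != 0 by rewrite normr_eq0.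
have /(dual_norm_ub f) : `|(`|x|)^-1 *: x| <= 1.
  by rewrite normrZ normfV normr_id mulVf.
rewrite f0 normr_le0 => /eqP.
have := dual_scalar f (`|x|)^-1 x 0; rewrite addr0 (dual0r f) addr0 => -> /eqP.
by rewrite mulf_eq0 invr_eq0 (negPf nx)/= => /eqP.
Qed.

HB.instance Definition _ :=
  Lmodule_isNormed.Build R dual dual_normD dual_normZ dual_norm0_eq0.

End Dual.

Arguments dual_pred {R} V.

Notation bidual V := (dual (dual V)).

Section Bidual.
Context {R : realType} {V : normedModType R}.

Lemma dual_le (f : dual V) x : `|f x| <= `|f| * `|x|.
Proof.
have [->|x0] := eqVneq x 0; first by rewrite dual0r !normr0 mulr0.
have nx : 0 < `|x| by rewrite normr_gt0.
have /(dual_norm_ub f) : `|(`|x|)^-1 *: x| <= 1.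
  by rewrite normrZ normfV normr_id mulVf// gt_eqF.
have := dual_scalar f (`|x|)^-1 x 0; rewrite addr0 (dual0r f) addr0 => ->.
by rewrite normrM normfV normr_id ler_pdivrMl// mulrC.
Qed.

Definition eval_at (x : V) : dual V -> R^o := fun f => f x.

Lemma eval_at_dual x : eval_at x \in dual_pred (dual V).
Proof.
have ls : scalar (eval_at x) by move=> a f g; rewrite /eval_at dualD dualZ.
apply/asboolP; split=> //.
pose le : {linear dual V -> R^o} :=
  HB.pack (eval_at x) (GRing.isLinear.Build R (dual V) R^o _ (eval_at x) ls).
have : bounded_near le (nbhs (0 : dual V)).
  apply/bounded_funP => r; exists (r * `|x|) => f fr.
  by rewrite (le_trans (dual_le f x))// ler_wpM2r.
by move/linear_bounded_continuous.
Qed.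

Definition canonical_embedding (x : V) : bidual V :=
  exist _ (eval_at x) (eval_at_dual x).

Lemma canonical_embeddingP a x y : canonical_embedding (a *: x + y) =
  a *: canonical_embedding x + canonical_embedding y.
Proof. by apply/val_inj/funext => f; exact: dual_scalar. Qed.

(* The image of Y under the canonical embedding; it plays the role of Y in the
   statement that Y, a subspace of V, has a property in the bidual of V. *)
Definition in_bidual (Y : submodClosed V) : {pred bidual V} :=
  [pred F | `[< exists2 y, y \in Y & F = canonical_embedding y >]].

Lemma in_bidual_submod Y : subsemimod_closed (in_bidual Y).
Proof.
have c0 : canonical_embedding 0 = 0.
  by have := canonical_embeddingP (-1) 0 0;
    rewrite scaler0 addr0 scaleN1r addNr.
split; first split.
- by apply/asboolP; exists 0; [exact: rpred0|].
- move=> _ _ /asboolP[x Yx ->] /asboolP[y Yy ->]; apply/asboolP.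
  exists (x + y); first exact: rpredD.
  by have := canonical_embeddingP 1 x y; rewrite !scale1r.
- move=> a _ /asboolP[x Yx ->]; apply/asboolP.
  exists (a *: x); first exact: rpredZ.
  by have := canonical_embeddingP a x 0; rewrite c0 !addr0.
Qed.

HB.instance Definition _ Y :=
  GRing.isSubmodClosed.Build R (bidual V) (in_bidual Y) (in_bidual_submod Y).

End Bidual.

Section Properties.
Context {R : realType}.

Definition norm_attaining (V : normedModType R) (f : dual V) :=
  exists2 x, unit_ball x & `|f x| = `|f|.

Definition norm_preserving_extension (Z : normedModType R)
    (Y : submodClosed Z) (f : dual (sub_normed Y)) (g : dual Z) :=
  (forall y : sub_normed Y, g (val y) = f y) /\ `|g| = `|f|.

Definition property_wU (Z : normedModType R) (Y : submodClosed Z) :=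
  forall f : dual (sub_normed Y), norm_attaining f ->
    exists! g : dual Z, norm_preserving_extension f g.

Definition weakly_hahn_banach_smooth (V : normedModType R) :=
  property_wU (in_bidual (whole_space : submodClosed V)).

Definition annihilator (Z : normedModType R) (J : submodClosed Z)
  : set (dual Z) := [set f | forall x, x \in J -> f x = 0].

Definition l1_direct_sum (V : normedModType R) (A B : set V) :=
  [/\ forall w, exists u v, [/\ A u, B v & w = u + v],
      A `&` B = [set 0] &
      forall u v, A u -> B v -> `|u + v| = `|u| + `|v|].

Definition M_ideal (Z : normedModType R) (J : submodClosed Z) :=
  closed [set` J] /\
  exists W : submodClosed (dual Z), l1_direct_sum (annihilator J) [set` W].

End Properties.

Section WeakTopologies.
Context {R : realType}.

(* Coarsest topology making all evaluations x |-> f x, f : dual V, continuous. *)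
Definition weak (V : normedModType R) :=
  initial_topology (fun x : V => (fun f : dual V => f x) : {ptws dual V -> R}).

(* Coarsest topology making all evaluations f |-> f x, x : V, continuous. *)
Definition weak_star (V : normedModType R) :=
  initial_topology (fun f : dual V => (f : V -> R) : {ptws V -> R}).

HB.instance Definition _ V := Topological.on (weak V).
HB.instance Definition _ V := Topological.on (weak_star V).

Variable X : normedModType R.

Definition ball_weak_star : topologicalType :=
  set_type (unit_ball : set (weak_star X)).

Definition ball_weak : topologicalType :=
  set_type (unit_ball : set (weak (dual X))).

Definition ball_id : ball_weak_star -> ball_weak := id.

Definition point_of_continuity (f : dual X) :=
  exists2 p : ball_weak_star, val p = f & {for p, continuous ball_id}.

End WeakTopologies.

Section C0.
Context (R : realType) (L : topologicalType).

Definition vanishes_at_infinity (f : L -> R) :=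
  forall e : R, 0 < e -> compact [set x | e <= `|f x|].

Definition C0_pred : {pred L -> R^o} :=
  [pred f : L -> R^o | `[< continuous f /\ vanishes_at_infinity f >]].

Definition C0 : Type := {f : L -> R^o | f \in C0_pred}.

Lemma closed_ge_norm (f : L -> R^o) e :
  continuous f -> closed [set x | e <= `|f x|].
Proof.
move=> cf; apply: (@preimage_closed _ _ (fun x => `|f x|) [set r | e <= r]).
  by move=> x _; apply: cvg_norm; exact: cf.
exact: closed_ge.
Qed.

Lemma C0_pred_submod : subsemimod_closed C0_pred.
Proof.
split; first split.
- apply/asboolP; split; first by move=> x; exact: cst_continuous.
  move=> e e0; rewrite (_ : [set _ | _] = set0); first exact: compact0.
  by rewrite -subset0 => x /=; rewrite normr0 leNgt e0.
- move=> f g /asboolP[cf vf] /asboolP[cg vg].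
  have cfg : continuous (f + g).
    by move=> x; apply: continuousD; [exact: cf|exact: cg].
  apply/asboolP; split=> // e e0.
  have e20 : 0 < e / 2 by rewrite divr_gt0.
  apply: (subclosed_compact _ (compactU (vf _ e20) (vg _ e20))).
    exact: closed_ge_norm.
  move=> x /= efg; have [|] := leP (e / 2) `|f x|; first by left.
  move=> fe; right; rewrite leNgt; apply/negP => ge.
  have := le_lt_trans (ler_normD (f x) (g x)) (ltrD fe ge).
  by rewrite -splitr ltNge efg.
- move=> a f /asboolP[cf vf].
  have caf : continuous (a *: f).
    by move=> x; apply: (@cvgM _ _ (nbhs x) _ (fun=> a) f);
      [exact: cvg_cst|exact: cf].
  apply/asboolP; split=> // e e0.
  have a10 : 0 < `|a| + 1 by rewrite ltr_wpDl.
  apply: (subclosed_compact _ (vf (e / (`|a| + 1)) _)).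
  + exact: closed_ge_norm.
  + by rewrite divr_gt0.
  + move=> x /=; rewrite normrM ler_pdivrMr// => /le_trans; apply.
    by rewrite mulrC ler_wpM2l// lerDl.
Qed.

HB.instance Definition _ :=
  GRing.isSubmodClosed.Build R (L -> R^o) C0_pred C0_pred_submod.
HB.instance Definition _ := SubChoice.on C0.
HB.instance Definition _ := [SubChoice_isSubLmodule of C0 by <:].

Definition C0_fun (f : C0) : L -> R := val f.
Coercion C0_fun : C0 >-> Funclass.

Implicit Types f g : C0.

(* For empty L this is sup set0 = 0. *)
Definition sup_norm (f : C0) : R := sup (range (fun x => `|f x|)).

Lemma C0_bounded (f : C0) : exists M, forall x, `|f x| <= M.
Proof.
have /asboolP[cf vf] := valP f.
have fK : compact ((f : L -> R^o) @` [set x | 1 <= `|f x|]).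
  apply: continuous_compact; last exact: (vf 1 ltr01).
  exact: continuous_subspaceT.
have [N [_ NP]] := compact_bounded fK.
pose M := N + 1; have MP y : (f @` [set x | 1 <= `|f x|]) y -> `|y| <= M.
  by apply: NP; rewrite ltrDl.
exists (Num.max 1 M) => x; rewrite le_max.
have [//|/ltW f1] := leP `|f x| 1.
by apply: MP; exists x.
Qed.

Lemma sup_norm_ub f x : `|f x| <= sup_norm f.
Proof.
apply: ub_le_sup; last by exists x.
by have [M fM] := C0_bounded f; exists M => _ [y _ <-].
Qed.

Lemma sup_norm_ge0 f : 0 <= sup_norm f.
Proof.
have [[_ [x _ _]]|ne] := pselect (range (fun x => `|f x|) !=set0).
  exact: le_trans (normr_ge0 (f x)) (sup_norm_ub f x).
by rewrite /sup_norm sup_out// => -[].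
Qed.

Lemma sup_norm_le f M : 0 <= M -> (forall x, `|f x| <= M) -> sup_norm f <= M.
Proof.
move=> M0 fM; rewrite /sup_norm.
have [->|/set0P ne] := eqVneq (range (fun x => `|f x|)) set0.
  by rewrite sup0.
by apply: ge_sup => // _ [x _ <-].
Qed.

Lemma sup_normD f g : sup_norm (f + g) <= sup_norm f + sup_norm g.
Proof.
apply: sup_norm_le => [|x]; first by rewrite addr_ge0// sup_norm_ge0.
by rewrite (le_trans (ler_normD _ _))// lerD// sup_norm_ub.
Qed.

Lemma sup_normZ a f : sup_norm (a *: f) = `|a| * sup_norm f.
Proof.
have le b g : sup_norm (b *: g) <= `|b| * sup_norm g.
  apply: sup_norm_le => [|x]; first by rewrite mulr_ge0// sup_norm_ge0.
  rewrite (_ : (b *: g : C0) x = b * g x)// normrM ler_wpM2l//.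
  exact: sup_norm_ub.
apply/le_anti; rewrite le/=.
have [->|a0] := eqVneq a 0; first by rewrite normr0 mul0r sup_norm_ge0.
rewrite -ler_pdivlMl ?normr_gt0// -normfV -{1}[f]scale1r -(mulVf a0) -scalerA.
exact: le.
Qed.

Lemma sup_norm0_eq0 f : sup_norm f = 0 -> f = 0.
Proof.
move=> f0; apply/val_inj/funext => x /=; apply/eqP.
by rewrite -normr_le0 -f0; exact: sup_norm_ub.
Qed.

HB.instance Definition _ :=
  Lmodule_isNormed.Build R C0 sup_normD sup_normZ sup_norm0_eq0.

End C0.

(* Main.v *)
(* Riesz representation is avoided: elements of the bidual of X = C_0(L) are
   obtained as limits, along ultrafilters, of elements of the unit ball of X.
   Write delta_x for the evaluation at x.

   If x is isolated, e = 1_{x} and delta_x satisfy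
   |h| = max(|h x|, |h - h(x) e|). This splits off a one-dimensional l1-summand
   of X^* and passes to the bidual, which refutes (b)-(f).

   If no point is isolated, let f be a norm-one point of continuity. For every
   finite S, f is a weak-* limit of combinations of norm at most 1 of
   evaluations at points off S: take a partition of unity adapted to finitely
   many functions, and move its nodes away from S. Hence F f = 0 for all F in
   X^** killing every delta_x with x off S. But there is such an F with
   F f <> 0: either functions in the ball vanishing on arbitrary finite sets
   keep f >= 1/2, and S is empty; or some S is an obstruction, and f charges
   functions concentrated near S.

   For (d)-(f), let y in Y attain its norm at x, and let F in X^** be the
   functional mu |-> mu({x}). The restriction of delta_x to Y has two norm-one
   extensions to X^**: evaluation at delta_x, and an ultrafilter limit of
   evaluations at delta_t, t -> x, t <> x; F separates them. When Y = J is an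
   M-ideal with complement W, delta_t is an extreme point, so it lies in W for t
   near x, and J^* embeds in W by Hahn-Banach, so F also acts on J^*. *)
From HB Require Import structures.
Require Import Defs.
From mathcomp Require Import all_boot all_order all_algebra.
From mathcomp Require Import all_classical all_reals all_analysis.
From mathcomp Require Import ring lra.

Import Order.TTheory GRing.Theory Num.Theory.
Import numFieldNormedType.Exports.
Local Open Scope classical_set_scope.
Local Open Scope ring_scope.

(** * Arithmetic and norm estimates for bounded functionals *)

Lemma dual_lin {R : realType} {V : normedModType R} (f : dual V) a u v :
  f (a *: u + v) = a * f u + f v.
Proof. exact: dual_scalar. Qed.

Lemma dualDr {R : realType} {V : normedModType R} (f : dual V) u v :
  f (u + v) = f u + f v.
Proof. by have := dual_lin f 1 u v; rewrite scale1r mul1r. Qed.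

Lemma dualZr {R : realType} {V : normedModType R} (f : dual V) a u :
  f (a *: u) = a * f u.
Proof. by have := dual_lin f a u 0; rewrite !addr0 dual0r addr0. Qed.

Lemma dualNr {R : realType} {V : normedModType R} (f : dual V) u :
  f (- u) = - f u.
Proof. by rewrite -scaleN1r dualZr mulN1r. Qed.

Lemma dualBr {R : realType} {V : normedModType R} (f : dual V) u v :
  f (u - v) = f u - f v.
Proof. by rewrite dualDr dualNr. Qed.

Lemma dualB {R : realType} {V : normedModType R} (f g : dual V) x :
  (f - g : dual V) x = f x - g x.
Proof. by rewrite -[- g]scaleN1r dualD dualZ mulN1r. Qed.

Lemma dual_sum {R : realType} {V : normedModType R} (I : Type) (r : seq I)
    (f : I -> dual V) x : (\sum_(i <- r) f i : dual V) x = \sum_(i <- r) f i x.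
Proof.
elim: r => [|i r IH]; first by rewrite !big_nil.
by rewrite !big_cons dualD IH.
Qed.

Lemma dual_sumr {R : realType} {V : normedModType R} (I : Type) (r : seq I)
    (f : dual V) (v : I -> V) : f (\sum_(i <- r) v i) = \sum_(i <- r) f (v i).
Proof.
elim: r => [|i r IH]; first by rewrite !big_nil dual0r.
by rewrite !big_cons dualDr IH.
Qed.

Lemma dual_ext {R : realType} {V : normedModType R} (f g : dual V) :
  (forall x, f x = g x) -> f = g.
Proof. by move=> fg; apply/val_inj/funext. Qed.

Lemma norm_dual_le {R : realType} {V : normedModType R} (f : dual V) M :
  (forall x, `|x| <= 1 -> `|f x| <= M) -> `|f| <= M.
Proof. exact: dual_norm_le. Qed.

Lemma dual_ball_le {R : realType} {V : normedModType R} (f : dual V) x :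
  `|x| <= 1 -> `|f x| <= `|f|.
Proof. exact: dual_norm_ub. Qed.

Lemma unit_dual_le {R : realType} {V : normedModType R} (f : dual V) x :
  `|f| <= 1 -> `|f x| <= `|x|.
Proof.
by move=> f1; rewrite (le_trans (dual_le f x))// ler_piMl.
Qed.

Lemma canonical_embeddingE {R : realType} {V : normedModType R} (x : V)
    (f : dual V) :
  canonical_embedding x f = f x.
Proof. by []. Qed.

Lemma canonical_embedding_norm_le {R : realType} {V : normedModType R} (x : V) :
  `|canonical_embedding x| <= `|x|.
Proof.
apply: norm_dual_le => f f1; rewrite canonical_embeddingE; exact: unit_dual_le.
Qed.

Lemma make_dual {R : realType} {V : normedModType R} (f : V -> R) M : 0 <= M ->
  (forall a u v, f (a *: u + v) = a * f u + f v) ->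
  (forall x, `|f x| <= M * `|x|) ->
  exists2 g : dual V, (forall x, g x = f x) & `|g| <= M.
Proof.
move=> M0 lf fM.
have fd : (f : V -> R^o) \in dual_pred V.
  apply/asboolP; split=> //.
  pose lf' : {linear V -> R^o} :=
    HB.pack (f : V -> R^o) (GRing.isLinear.Build R V R^o _ f lf).
  have : bounded_near lf' (nbhs (0 : V)).
    apply/bounded_funP => r; exists (M * r) => x xr.
    by rewrite (le_trans (fM x))// ler_wpM2l.
  by move/linear_bounded_continuous.
exists (exist _ (f : V -> R^o) fd : dual V) => //.
apply: norm_dual_le => x x1; apply: (le_trans (fM x)).
by rewrite ler_piMr.
Qed.

(** * Functionals of the bidual as ultrafilter limits *)

(** By compactness of [[- M, M]] the image ultrafilter clusters somewhere, and an ultrafilter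
    converges to each of its cluster points. *)
Lemma ultra_cvg_bounded {R : realType} {T : Type} {U : set_system T}
    (UU : UltraFilter U) (f : T -> R) M :
  (\forall t \near U, `|f t| <= M) -> cvg (f t @[t --> U]).
Proof.
move=> fM.
have UP : ProperFilter U := ultra_proper.
have [|p [_ clp]] := @segment_compact R (- M) M (f @ U) _.
  by apply: filterS fM => t /=; rewrite in_itv/= ler_norml.
apply/cvg_ex; exists p => B pB.
have [//|nB] := in_ultra_setVsetC (f @^-1` B) UU.
have : (f @ U) (~` B) by [].
by move=> /clp/(_ pB)[x [nBx Bx]].
Qed.

(** The limits of [g (v t)] are linear and bounded in [g]. This replaces weak-star compactness of
    the bidual ball. *)
Lemma bidual_ultralim {R : realType} {V : normedModType R} {T : Type}
    {U : set_system T} (UU : UltraFilter U) (v : T -> V) :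
  (\forall t \near U, `|v t| <= 1) ->
  exists2 F : bidual V, `|F| <= 1 & forall g : dual V,
    (fun t => g (v t)) @ U --> F g.
Proof.
move=> v1.
have UP : ProperFilter U := ultra_proper.
have cv (g : dual V) : cvg (g (v t) @[t --> U]).
  apply: (@ultra_cvg_bounded _ _ _ _ _ `|g|).
  by apply: filterS v1 => t; exact: dual_ball_le.
pose F (g : dual V) := lim (g (v t) @[t --> U]).
have Fb (g : dual V) : `|F g| <= `|g|.
  apply: (cvgr_to_le (f := fun t => `|g (v t)|) (F := U)).
    by apply: cvg_norm; exact: cv.
  by apply: filterS v1 => t /=; exact: dual_ball_le.
have [||G GF G1] := @make_dual R (dual V) F 1 ler01.
- move=> a f g; apply: cvg_lim => //.
  apply: cvgD; last exact: cv.
  by apply: cvgMr; exact: cv.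
- by move=> g; rewrite mul1r; exact: Fb.
by exists G => // g; rewrite GF; exact: cv.
Qed.

(** The ball vectors with [c <= f h] on which finitely many [ev t] vanish form a filter base; a
    limit along a finer ultrafilter keeps these closed conditions for all [t] in [A] at once. *)
Lemma bidual_fip {R : realType} {V : normedModType R} {T : choiceType}
    (A : set T) (ev : T -> dual V) (f : dual V) (c : R) :
  (forall s : seq T, (forall t, t \in s -> A t) ->
     exists h : V,
       [/\ `|h| <= 1, c <= f h & forall t, t \in s -> ev t h = 0]) ->
  exists F : bidual V, c <= F f /\ forall t, A t -> F (ev t) = 0.
Proof.
move=> fip.
pose D := [set s : seq T | forall t, t \in s -> A t].
pose B (s : seq T) :=
  [set h : V | [/\ `|h| <= 1, c <= f h & forall t, t \in s -> ev t h = 0]].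
have FF : Filter (filter_from D B).
  apply: filter_from_filter; first by exists [::].
  move=> s t Ds Dt; exists (s ++ t).
    by move=> x; rewrite mem_cat => /orP[/Ds|/Dt].
  move=> h [h1 ch hst]; split; split=> // x xs; apply: hst;
    by rewrite mem_cat xs// orbT.
have PF : ProperFilter (filter_from D B).
  by apply: filter_from_proper => s /fip[h ?]; exists h.
have [U [UU FU]] := ultraFilterLemma PF.
have UP : ProperFilter U := ultra_proper.
have UB s : D s -> U (B s) by move=> Ds; apply: FU; exists s.
have [|F _ FU'] := bidual_ultralim UU id.
  by have : U (B [::]) by [exact: UB]; apply: filterS => h [].
exists F; split.
  apply: (cvgr_to_ge (FU' f)).
  by have : U (B [::]) by [exact: UB]; apply: filterS => h [].
move=> t At; have UBt : U (B [:: t]).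
  by apply: UB => k; rewrite inE => /eqP ->.
apply/eqP; rewrite eq_le; apply/andP; split.
  apply: (cvgr_to_le (FU' (ev t))).
  by apply: filterS UBt => h [_ _ ->]//; rewrite inE.
apply: (cvgr_to_ge (FU' (ev t))).
by apply: filterS UBt => h [_ _ ->]//; rewrite inE.
Qed.

(** * Weak and weak-star convergence, points of continuity *)

Lemma cvg_initialP {S : choiceType} {T : topologicalType} (f : S -> T)
    (F : set_system S) (FF : Filter F) (s : S) :
  F --> (s : initial_topology f) <-> f @ F --> f s.
Proof.
split=> [Fs|Ffs].
  by apply: cvg_trans (@initial_continuous _ _ f s); exact: cvg_app.
move=> A; rewrite nbhsE => -[B [[C oC <-] Cfs] BA].
apply: filterS BA _; apply: Ffs; exact: open_nbhs_nbhs.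
Qed.

(** The topology is initial twice over: for the inclusion of the ball, then for the evaluations.
    Peeling off both leaves pointwise convergence. *)
Lemma ball_weak_star_cvgP {R : realType} {X : normedModType R}
    (G : set_system (ball_weak_star X)) (FG : Filter G) (p : ball_weak_star X) :
  G --> p <->
  forall h : X, (fun q => (val q : dual X) h) @ G --> (val p : dual X) h.
Proof.
rewrite (cvg_initialP set_val).
rewrite (cvg_initialP (fun f : dual X => (f : X -> R) : {ptws X -> R})).
by rewrite pointwise_cvgP.
Qed.

Lemma ball_weak_cvgP {R : realType} {X : normedModType R}
    (G : set_system (ball_weak X)) (FG : Filter G) (p : ball_weak X) :
  G --> p <-> forall F : bidual X,
    (fun q => F (val q : dual X)) @ G --> F (val p : dual X).
Proof.
rewrite (cvg_initialP set_val) (cvg_initialP (fun f : dual X =>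
  (fun F : bidual X => F f) : {ptws bidual X -> R})).
by rewrite pointwise_cvgP.
Qed.

(** [D] meets every weak-star neighbourhood of [f], so a filter on [D] converges weak-star to [f];
    continuity makes it converge weakly, and [F = 0] on [D] passes to the limit. *)
Lemma point_of_continuity_vanish {R : realType} {X : normedModType R}
    (f : dual X) (D : set (dual X)) (F : bidual X) :
  point_of_continuity f ->
  (forall d, D d -> `|d| <= 1) ->
  (forall (s : seq X) (e : R), 0 < e ->
    exists2 d : dual X, D d & forall h, h \in s -> `|d h - f h| < e) ->
  (forall d, D d -> F d = 0) -> F f = 0.
Proof.
move=> [p <- cp] D1 Df FD.
pose B (i : seq X * R) : set (ball_weak_star X) :=
  [set q | D (val q) /\ forall h : X, h \in i.1 ->
    `|(val q : dual X) h - (val p : dual X) h| < i.2].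
have FF : Filter (filter_from [set i : seq X * R | 0 < i.2] B).
  apply: filter_from_filter; first by exists ([::], 1) => /=.
  move=> [s e] [t e'] /= e0 e'0; exists (s ++ t, Num.min e e') => /=.
    by rewrite lt_min e0.
  move=> q [Dq /= qst]; split; split=> //= h hs.
    by have := qst h; rewrite mem_cat hs lt_min => /(_ isT)/andP[].
  by have := qst h; rewrite mem_cat hs orbT lt_min => /(_ isT)/andP[].
have PF : ProperFilter (filter_from [set i : seq X * R | 0 < i.2] B).
  apply: filter_from_proper => -[s e] /= e0.
  have [d Dd ds] := Df s e e0.
  have dball : d \in (unit_ball : set (weak_star X)).
    by apply/mem_set; exact: D1.
  by exists (exist _ d dball : ball_weak_star X).
have Gp : filter_from [set i : seq X * R | 0 < i.2] B --> p.
  apply/ball_weak_star_cvgP => h; apply/cvgrPdist_lt => e e0.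
  exists ([:: h], e) => //= q [_ /(_ h)]; rewrite inE eqxx => /(_ isT).
  by rewrite distrC.
have /ball_weak_cvgP/(_ F) := cvg_trans (cvg_app (@ball_id _ X) Gp) cp.
move=> FG; apply/eqP; rewrite eq_le; apply/andP; split.
  apply: (cvgr_to_le FG); exists ([::], 1) => //= q [Dq _].
  by have /eqP := FD _ Dq; rewrite eq_le => /andP[].
apply: (cvgr_to_ge FG); exists ([::], 1) => //= q [Dq _].
by have /eqP := FD _ Dq; rewrite eq_le => /andP[].
Qed.

(** * Restrictions and one-dimensional M-summands *)

Lemma dual_restrict {R : realType} {Z : normedModType R} (Y : submodClosed Z)
    (g : dual Z) :
  exists2 f : dual (sub_normed Y), (forall y, f y = g (val y)) & `|f| <= `|g|.
Proof.
apply: make_dual => //; first by move=> a u v; exact: dual_lin.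
by move=> x; exact: dual_le.
Qed.

Lemma normD_same_sign {R : realDomainType} (x y : R) :
  0 <= x * y -> `|x + y| = `|x| + `|y|.
Proof.
have [x0|x0] := leP 0 x; have [y0|y0] := leP 0 y => xy;
  rewrite ?(ger0_norm x0) ?(ltr0_norm x0) ?(ger0_norm y0) ?(ltr0_norm y0).
- by rewrite ger0_norm// addr_ge0.
- have /eqP : x = 0; last by move=> /eqP ->; rewrite !add0r ltr0_norm.
  by apply/eqP; rewrite eq_le x0 andbT -(nmulr_lge0 _ y0).
- have /eqP : y = 0; last by move=> /eqP ->; rewrite !addr0 ltr0_norm.
  by apply/eqP; rewrite eq_le y0 andbT -(nmulr_rge0 _ x0).
- by rewrite ltr0_norm; lra.
Qed.

(* R e is then an M-summand of V, with complement the kernel of d. *)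
Definition M_line {R : realType} {V : normedModType R} (e : V) (d : dual V) :=
  d e = 1 /\ forall h, `|h| = Num.max `|d h| `|h - d h *: e|.

Lemma M_line_norm {R : realType} {V : normedModType R} {e : V} {d : dual V} :
  M_line e d -> `|e| = 1.
Proof.
by move=> [de ->]; rewrite de scale1r subrr normr0 normr1 maxEle ler10.
Qed.

(** The max norm dualises to an l1 norm. For the lower bound on [|q|], a ball vector is replaced by
    its component [k] in the kernel of [d], and [e] is added with the sign for which [q k] and [q e]
    do not cancel. *)
Lemma M_line_dual {R : realType} {V : normedModType R} {e : V} {d : dual V} :
  M_line e d -> forall q : dual V, `|q| = `|q e| + `|q - q e *: d|.
Proof.
move=> [de dh] q; apply/eqP; rewrite eq_le; apply/andP; split.
  have d1 : `|d| <= 1.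
    by apply: norm_dual_le => x; rewrite dh ge_max => /andP[].
  rewrite -{1}[q](subrK (q e *: d)) addrC (le_trans (ler_normD _ _))//.
  by rewrite lerD2r normrZ ler_piMr.
rewrite addrC -lerBrDr; apply: norm_dual_le => h h1.
pose k := h - d h *: e.
have dk : d k = 0 by rewrite dualBr dualZr de mulr1 subrr.
have k1 : `|k| <= 1 by move: h1; rewrite dh ge_max => /andP[].
have qk : (q - q e *: d : dual V) h = q k.
  by rewrite dualB dualZ dualBr dualZr mulrC.
have E (s : R) : `|s| = 1 -> `|k + s *: e| <= 1.
  move=> s1; rewrite dh dualDr dk dualZr de mulr1 add0r addrK s1.
  by rewrite ge_max lexx.
rewrite qk lerBrDr.
have [s1|s1] := leP 0 (q k * q e).
  have : `|q k| + `|q e| = `|q (k + 1 *: e)|.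
    by rewrite scale1r (dualDr q k) normD_same_sign.
  by move=> ->; apply: dual_ball_le; apply: E; rewrite normr1.
have : `|q k| + `|q e| = `|q (k + (-1) *: e)|.
  rewrite scaleN1r (dualBr q k) normD_same_sign ?normrN//.
  by rewrite mulrN oppr_ge0 ltW.
by move=> ->; apply: dual_ball_le; apply: E; rewrite normrN1.
Qed.

Lemma M_line_dual_norm {R : realType} {V : normedModType R} {e : V}
    {d : dual V} : M_line e d -> `|d| = 1.
Proof.
move=> Med; rewrite (M_line_dual Med) Med.1.
by rewrite scale1r subrr normr0 normr1 addr0.
Qed.

(** Dualising the l1 splitting of the dual gives back a max norm; [F0] is the component of [F] that
    vanishes at [d]. *)
Lemma M_line_bidual {R : realType} {V : normedModType R} {e : V} {d : dual V} :
  M_line e d -> M_line (canonical_embedding e) (canonical_embedding d).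
Proof.
move=> Med; have q0 := M_line_dual Med; have [de dh] := Med.
have d1 := M_line_dual_norm Med.
suff FM (F : bidual V) :
    `|F| = Num.max `|F d| `|F - F d *: canonical_embedding e|.
  by split=> //; rewrite !canonical_embeddingE.
set F0 : bidual V := F - F d *: canonical_embedding e.
have FE (q : dual V) : F q = F0 (q - q e *: d) + F d * q e.
  rewrite /F0 !dualB dualZ canonical_embeddingE dualB dualZ de.
  by rewrite !dualBr !dualZr; ring.
apply/eqP; rewrite eq_le; apply/andP; split.
  suff le1 (q : dual V) : `|q| <= 1 -> `|F q| <= Num.max `|F d| `|F0|.
    exact: norm_dual_le.
  move=> q1; rewrite FE (le_trans (ler_normD _ _))//.
  rewrite normrM; set m := Num.max _ _.
  have m0 : 0 <= m by rewrite le_max normr_ge0.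
  rewrite (@le_trans _ _ (m * `|q - q e *: d| + m * `|q e|))//.
    apply: lerD; last by rewrite ler_wpM2r// le_max lexx.
    by rewrite (le_trans (dual_le _ _))// ler_wpM2r// le_max lexx orbT.
  by rewrite -mulrDr addrC -q0 ler_piMr.
rewrite ge_max; apply/andP; split; first by rewrite dual_ball_le// d1.
suff le1 (q : dual V) : `|q| <= 1 -> `|F0 q| <= `|F|.
  exact: norm_dual_le.
move=> q1; have -> : F0 q = F (q - q e *: d).
  by rewrite /F0 dualB dualZ canonical_embeddingE dualBr dualZr mulrC.
rewrite dual_ball_le// (le_trans _ q1)// q0 lerDr//.
Qed.

(** Even norm continuity holds: if [w] is in the ball and [w e] is near 1, then
    [|w - w e *: d| = |w| - |w e|] is small. *)
Lemma M_line_continuity {R : realType} {V : normedModType R} {e : V}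
  {d : dual V} : M_line e d -> point_of_continuity d.
Proof.
move=> Med; have q0 := M_line_dual Med; have [de dh] := Med.
have d1 := M_line_dual_norm Med.
have dball : d \in (unit_ball : set (weak_star V)).
  by apply/mem_set; rewrite /unit_ball/= d1.
pose p : ball_weak_star V := exist _ d dball.
have pF : Filter (nbhs p) := nbhs_filter p.
exists p => //.
suff : (nbhs p : set_system (ball_weak V)) --> (p : ball_weak V) by [].
apply/(@ball_weak_cvgP _ _ (nbhs p) pF) => F.
have /(@ball_weak_star_cvgP _ _ (nbhs p) pF)/(_ e) /= := @cvg_id _ (nbhs p).
rewrite de => /cvgrPdist_lt qe; apply/cvgrPdist_lt => eps eps0.
have F1 : 0 < `|F| + 1 by rewrite ltr_wpDl.
(* The l1 formula and [|w| <= 1] give [|d - w| <= 2 * |1 - w e|], hence the factor 1/2; [|F| + 1]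
   keeps the denominator positive. *)
have e2 : 0 < eps / (`|F| + 1) / 2 by rewrite !divr_gt0.
near=> q.
have [q1 qd] : `|val q : dual V| <= 1 /\
    `|1 - (val q : dual V) e| < eps / (`|F| + 1) / 2.
  split; last by near: q; exact: qe.
  by have /set_mem := valP q.
set w : dual V := val q in q1 qd *.
have wd : `|d - w| < eps / (`|F| + 1).
  have : `|d - w| <= `|1 - w e| + `|w - w e *: d|.
    have -> : d - w = (1 - w e) *: d - (w - w e *: d).
      by rewrite scalerBl scale1r opprB addrA subrK.
    by rewrite (le_trans (ler_normB _ _))// normrZ d1 mulr1.
  have := q0 w; have : 1 - w e <= `|1 - w e| by exact: ler_norm.
  have : w e <= `|w e| by exact: ler_norm.
  move: qd q1; set a := eps / _; lra.
rewrite /= -[X in `|X|](_ : F (d - w) = _); last exact: dualBr.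
rewrite (le_lt_trans (dual_le _ _))//.
rewrite (@le_lt_trans _ _ ((`|F| + 1) * `|d - w|))//.
  by rewrite ler_wpM2r// lerDl.
by rewrite mulrC -ltr_pdivlMr.
Unshelve. all: by end_near. Qed.

(** A norm-preserving extension [g] has [g e = c] and [|g| = |c|], so the l1 formula leaves norm 0
    for [g - c *: d]. *)
Lemma M_line_wU {R : realType} {Z : normedModType R} {e : Z} {d : dual Z}
    (Y : submodClosed Z) : M_line e d ->
  (forall x, x \in Y <-> exists a : R, x = a *: e) -> property_wU Y.
Proof.
move=> Med YE f _; have q0 := M_line_dual Med; have [de dh] := Med.
have e1 := M_line_norm Med.
have d1 := M_line_dual_norm Med.
have Ye : e \in Y by apply/YE; exists 1; rewrite scale1r.
pose ey : sub_normed Y := exist _ e Ye; pose c := f ey.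
have yE (y : sub_normed Y) : exists2 a, y = a *: ey & val y = a *: e.
  have /YE[a ya] := valP y; exists a => //; apply: val_inj.
  by rewrite linearZ.
have fc : `|f| = `|c|.
  apply/eqP; rewrite eq_le; apply/andP; split.
    apply: norm_dual_le => y y1; have [a ya vy] := yE y.
    rewrite ya dualZr normrM ler_piMl//.
    by move: y1; rewrite -[`|y|]/(`|val y|) vy normrZ e1 mulr1.
  by apply: dual_ball_le; rewrite -[`|ey|]/(`|e|) e1.
exists (c *: d); split.
  split; last by rewrite normrZ d1 mulr1 fc.
  by move=> y; have [a -> ->] := yE y; rewrite dualZ !dualZr de mulr1 mulrC.
move=> g [gf gn].
have ge : g e = c by rewrite -[e]/(val ey) gf.
have := q0 g; rewrite gn fc ge -{1}[`|c|]addr0 => /addrI/esym/eqP.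
by rewrite normr_eq0 subr_eq0 => /eqP.
Qed.

Lemma M_line_wU_bidual {R : realType} {V : normedModType R} {e : V}
    {d : dual V} (Y : submodClosed V) : M_line e d ->
  (forall x, x \in Y <-> exists a : R, x = a *: e) -> property_wU (in_bidual Y).
Proof.
move=> /M_line_bidual Med YE; apply: (M_line_wU _ Med) => F; split.
  move=> /asboolP[y /YE[a ->] ->]; exists a.
  by apply: dual_ext => f; rewrite dualZ !canonical_embeddingE dualZr.
move=> [a ->]; apply/asboolP; exists (a *: e); first by apply/YE; exists a.
by apply: dual_ext => f; rewrite dualZ !canonical_embeddingE dualZr.
Qed.

(** [e] and the restriction of [d] again form an [M_line] inside [Y], where the line is the whole
    space. *)
Lemma M_line_smooth {R : realType} {V : normedModType R} {e : V} {d : dual V}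
    (Y : submodClosed V) : M_line e d ->
  (forall x, x \in Y <-> exists a : R, x = a *: e) ->
  weakly_hahn_banach_smooth (sub_normed Y).
Proof.
move=> [de dh] YE.
have [d' d'E _] := dual_restrict Y d.
have Ye : e \in Y by apply/YE; exists 1; rewrite scale1r.
apply: (@M_line_wU_bidual _ _ (exist _ e Ye : sub_normed Y) d').
  split; first by rewrite d'E.
  move=> h; rewrite d'E -[`|h|]/(`|val h|) dh.
  by [].
move=> x; split=> // _; have /YE[a xa] := valP x; exists a.
by apply: val_inj; rewrite linearZ.
Qed.

(** The splitting is [w = (w - w e *: d) + w e *: d], and the l1 formula makes the norms add. *)
Lemma M_line_M_ideal {R : realType} {V : normedModType R} {e : V} {d : dual V}
    (Y : submodClosed V) (W : submodClosed (dual V)) : M_line e d ->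
  (forall x, x \in Y <-> exists a : R, x = a *: e) ->
  (forall w : dual V, w \in W <-> exists a : R, w = a *: d) -> M_ideal Y.
Proof.
move=> Med YE WE; have q0 := M_line_dual Med; have [de dh] := Med.
have d1 := M_line_dual_norm Med.
have Ye : e \in Y by apply/YE; exists 1; rewrite scale1r.
split.
  have -> : [set` Y] = [set x | `|x - d x *: e| = 0].
    apply/seteqP; split=> x /=.
      by move=> /YE[a ->]; rewrite dualZr de mulr1 subrr normr0.
    by move/eqP; rewrite normr_eq0 subr_eq0 => /eqP ->; apply/YE; exists (d x).
  apply: (@preimage_closed _ _ (fun x => `|x - d x *: e|) [set r | r = 0]).
    move=> x _; apply: cvg_norm; apply: cvgB; first exact: cvg_id.
    by apply: cvgZl; exact: dual_continuous.
  exact: closed_eq.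
have dec (w : dual V) :
    exists u v, [/\ annihilator Y u, [set` W] v & w = u + v].
  exists (w - w e *: d), (w e *: d); split.
  + by move=> x /YE[a ->]; rewrite dualB dualZ !dualZr de; ring.
  + by apply/WE; exists (w e).
  + by rewrite subrK.
have int (w : dual V) : annihilator Y w -> w \in W -> w = 0.
  move=> ann /WE[a wa]; have := ann e Ye; rewrite wa dualZ de mulr1 => ->.
  by rewrite scale0r.
have add (u v : dual V) : annihilator Y u -> v \in W -> `|u + v| = `|u| + `|v|.
  move=> ann /WE[a ->]; have ue : u e = 0 by exact: ann.
  by rewrite q0 dualD ue dualZ de mulr1 add0r addrK addrC normrZ d1 mulr1.
exists W; split=> //; apply/seteqP; split=> [w [/int aw /aw]//|_ ->].
split; last exact: rpred0.
by move=> x _; rewrite -[0](subrr (0 : dual V)) dualB subrr.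
Qed.

(** * The Hahn-Banach theorem through minimal sublinear functionals *)

(** Homogeneity is asked only as an inequality for positive scalars, which suits infima; equality
    follows by applying it to the inverse scalar too. *)
Definition sublinear {R : realType} {V : lmodType R} (q : V -> R) :=
  (forall x y, q (x + y) <= q x + q y) /\
  (forall t x, 0 < t -> q (t *: x) <= t * q x).

Lemma sublinearZ {R : realType} {V : lmodType R} (q : V -> R) t x :
  sublinear q -> 0 <= t -> q (t *: x) = t * q x.
Proof.
move=> [_ qZ]; have pZ s y : 0 < s -> q (s *: y) = s * q y.
  move=> s0; apply/eqP; rewrite eq_le qZ//=.
  rewrite -ler_pdivlMl// -{1}[y](scalerK (a := s)) ?gt_eqF//.
  by apply: qZ; rewrite invr_gt0.
rewrite le_eqVlt => /orP[/eqP <-|/pZ//]; rewrite scale0r mul0r.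
(* [q 0 = q (2 *: 0) = 2 * q 0] forces [q 0 = 0]. *)
have : 0 < 2 :> R by [].
by move=> /(pZ _ 0); rewrite scaler0; lra.
Qed.

Lemma sublinear_ge {R : realType} {V : lmodType R} (q : V -> R) x :
  sublinear q -> - q (- x) <= q x.
Proof.
move=> sq; have := sq.1 x (- x); rewrite subrr.
by have := sublinearZ q 0 0 sq (lexx 0); rewrite scale0r mul0r => ->; lra.
Qed.

(** Common device for three infima: over a chain in Zorn's lemma, over translates along a direction,
    and over a subspace in the extension theorem. *)
Lemma sublinear_inf {R : realType} {V : lmodType R} (D : V -> set R) :
  (forall x, D x !=set0) -> (forall x, has_lbound (D x)) ->
  (forall x y a b, D x a -> D y b -> exists2 c, D (x + y) c & c <= a + b) ->
  (forall t x a, 0 < t -> D x a -> exists2 c, D (t *: x) c & c <= t * a) ->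
  sublinear (fun x => inf (D x)).
Proof.
move=> D0 Db DD DZ; split=> [x y|t x t0].
  rewrite -lerBlDr; apply: lb_le_inf => // a Da.
  rewrite lerBlDl -lerBlDr; apply: lb_le_inf => // b Db'.
  have [c Dc ca] := DD _ _ _ _ Da Db'.
  by rewrite lerBlDl (le_trans (ge_inf (Db _) Dc)).
rewrite -ler_pdivrMl//; apply: lb_le_inf => // a Da.
have [c Dc ca] := DZ _ _ _ t0 Da.
by rewrite ler_pdivrMl// (le_trans (ge_inf (Db _) Dc)).
Qed.

(** Zorn's lemma for the reversed pointwise order. A nonempty chain is bounded by its pointwise
    infimum, which is finite because [- p (- x) <= q x] whenever [q] is below [p]. *)
Lemma minimal_sublinear {R : realType} {V : lmodType R} (p : V -> R) :
  sublinear p -> exists q : V -> R, [/\ sublinear q, forall x, q x <= p x &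
    forall q', sublinear q' -> (forall x, q' x <= q x) ->
      forall x, q x <= q' x].
Proof.
move=> sp.
pose T := {q : V -> R | sublinear q /\ forall x, q x <= p x}.
pose leT (q1 q2 : T) := `[< forall x, sval q2 x <= sval q1 x >].
pose p0 : T := exist _ p (conj sp (fun x => lexx (p x))).
have [||A Atot|q qmin] := ZL_preorder p0 (R := leT).
- by move=> q; apply/asboolP.
- move=> q1 q2 q3 /asboolP q12 /asboolP q23; apply/asboolP => x.
  exact: le_trans (q23 x) (q12 x).
- have [->|/set0P[q0 Aq0]] := eqVneq A set0; first by exists p0.
  pose D x := [set sval q x | q in A].
  have Dlb x q : A q -> - p (- x) <= sval q x.
    move=> _; have [sq qp] := svalP q.
    by rewrite (le_trans _ (sublinear_ge (sval q) x sq))// lerN2.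
  have Db x : has_lbound (D x).
    by exists (- p (- x)) => _ [q Aq <-]; exact: Dlb.
  have si : sublinear (fun x => inf (D x)).
    apply: sublinear_inf => //.
    + by move=> x; exists (sval q0 x), q0.
    + move=> x y _ _ [q1 Aq1 <-] [q2 Aq2 <-].
      have [[q1D _] _] := svalP q1; have [[q2D _] _] := svalP q2.
      (* Two members of a chain are comparable, so the smaller one serves at both arguments. *)
      have [/asboolP q12|/asboolP q21] := Atot q1 q2 Aq1 Aq2.
        exists (sval q2 (x + y)); first by exists q2.
        by rewrite (le_trans (q2D x y))// lerD2r.
      exists (sval q1 (x + y)); first by exists q1.
      by rewrite (le_trans (q1D x y))// lerD2l.
    + move=> t x _ t0 [q Aq <-]; exists (sval q (t *: x)); first by exists q.
      by have [[_ qZ] _] := svalP q; exact: qZ.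
  have ip x : inf (D x) <= p x.
    have [_ q0p] := svalP q0.
    by apply: le_trans (q0p x); apply: ge_inf => //; exists q0.
  exists (exist _ (fun x => inf (D x)) (conj si ip)) => q Aq.
  apply/asboolP => x /=.
  by apply: ge_inf => //; exists q.
have [sq qp] := svalP q; exists (sval q); split=> // q' sq' q'q.
have q'p x : q' x <= p x by exact: le_trans (q'q x) (qp x).
have /asboolP := qmin (exist _ q' (conj sq' q'p)) (asboolT q'q); exact.
Qed.

(* For a minimal q and each x, the sublinear functional
   y |-> inf_(t >= 0) (q (y + t x) - t q x) is below q, hence equal to q;
   t = 1 gives q y + q x <= q (y + x). *)
Lemma sublinear_dominates_linear {R : realType} {V : lmodType R} (p : V -> R) :
  sublinear p -> exists2 q : V -> R,
    (forall a x y, q (a *: x + y) = a * q x + q y) & forall x, q x <= p x.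
Proof.
move=> /minimal_sublinear[q [sq qp qmin]]; exists q => //.
have q0 : q 0 = 0.
  by have := sublinearZ q 0 0 sq (lexx 0); rewrite scale0r mul0r.
have qD x y : q (x + y) = q x + q y.
  apply/eqP; rewrite eq_le sq.1/=.
  pose D z := [set q (z + t *: y) - t * q y | t in [set t | 0 <= t]].
  have Db z : has_lbound (D z).
    exists (- q (- z)) => _ [t /= t0 <-].
    rewrite -(sublinearZ q t y sq t0) lerBrDl.
    have := sq.1 (- z) (z + t *: y); rewrite addKr; lra.
  have sD : sublinear (fun z => inf (D z)).
    apply: sublinear_inf => //.
    - by move=> z; exists (q (z + 0 *: y) - 0 * q y), 0 => /=.
    - move=> z w _ _ [s /= s0 <-] [t /= t0 <-].
      exists (q (z + w + (s + t) *: y) - (s + t) * q y).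
        by exists (s + t) => //=; exact: addr_ge0.
      have := sq.1 (z + s *: y) (w + t *: y).
      by rewrite addrACA -scalerDl; lra.
    - move=> s z _ s0 [t /= t0 <-].
      exists (q (s *: z + (s * t) *: y) - (s * t) * q y).
        by exists (s * t) => //=; rewrite mulr_ge0// ltW.
      by rewrite -scalerA -scalerDr mulrBr mulrA lerB// sq.2.
  have Dq z t : 0 <= t -> inf (D z) <= q (z + t *: y) - t * q y.
    by move=> t0; apply: ge_inf => //; exists t.
  have Dqq z : inf (D z) <= q z.
    by have := Dq z 0 (lexx 0); rewrite scale0r addr0 mul0r subr0.
  have := qmin _ sD Dqq x.
  by have := Dq x 1 ler01; rewrite scale1r mul1r; lra.
have qN x : q (- x) = - q x.
  have := qD x (- x); rewrite subrr q0 => /esym/eqP.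
  by rewrite addrC addr_eq0 => /eqP.
move=> a x y; rewrite qD; congr (_ + _).
have [a0|a0] := leP 0 a; first exact: sublinearZ.
by rewrite -[a]opprK scaleNr qN sublinearZ ?mulNr// oppr_ge0 ltW.
Qed.

(** The infimum over [y] of [|f| * |z - y| + f y] is sublinear. A linear [q] below it satisfies
    [q z <= |f| * |z|] (take [y = 0]) and [q <= f] on [Y] (take [z = y]), so [q = f] there by
    changing signs. *)
Lemma hahn_banach {R : realType} {Z : normedModType R} (Y : submodClosed Z)
    (f : dual (sub_normed Y)) :
  exists2 g : dual Z, (forall y : sub_normed Y, g (val y) = f y) & `|g| <= `|f|.
Proof.
pose D (z : Z) := [set `|f| * `|z - val y| + f y | y in [set: sub_normed Y]].
have Dlb z y : - (`|f| * `|z|) <= `|f| * `|z - val y| + f y.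
  have := dual_le f y; rewrite ler_norml => /andP[+ _].
  have : `|val y| <= `|z - val y| + `|z|.
    by rewrite -{1}[val y](subrK z) (le_trans (ler_normD _ _))// distrC.
  move=> /(ler_wpM2l (normr_ge0 f)).
  rewrite mulrDr -[`|y|]/(`|val y|); lra.
have Db z : has_lbound (D z).
  by exists (- (`|f| * `|z|)) => _ [y _ <-].
have sD : sublinear (fun z => inf (D z)).
  apply: sublinear_inf => //.
  - by move=> z; exists (`|f| * `|z - val (0 : sub_normed Y)| + f 0), 0.
  - move=> z w _ _ [y _ <-] [y' _ <-].
    exists (`|f| * `|z + w - val (y + y')| + f (y + y')).
      by exists (y + y').
    rewrite dualDr [leRHS]addrACA lerD2r -mulrDr ler_wpM2l//.
    by rewrite -[val (y + y')]/(val y + val y') opprD addrACA ler_normD.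
  - move=> t z _ t0 [y _ <-].
    exists (`|f| * `|t *: z - val (t *: y)| + f (t *: y)).
      by exists (t *: y).
    rewrite dualZr mulrDr lerD2r -[val (t *: y)]/(t *: val y) -scalerBr.
    by rewrite normrZ (gtr0_norm t0) mulrCA.
have Dle z y : inf (D z) <= `|f| * `|z - val y| + f y.
  by apply: ge_inf => //; exists y.
have [q ql qD] := sublinear_dominates_linear _ sD.
have qN z : q (- z) = - q z.
  have q0 : q 0 = 0 by have := ql (-1) 0 0; rewrite scaler0 addr0 mulN1r addNr.
  by have := ql (-1) z 0; rewrite !addr0 q0 addr0 scaleN1r mulN1r.
have qf z : q z <= `|f| * `|z|.
  have := le_trans (qD z) (Dle z 0).
  by rewrite -[val 0]/(0 : Z) subr0 dual0r addr0.
have qfy (y : sub_normed Y) : q (val y) <= f y.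
  by have := le_trans (qD _) (Dle (val y) y); rewrite subrr normr0 mulr0 add0r.
have [|g gq gf] := make_dual q _ (normr_ge0 f) ql.
  by move=> x; rewrite ler_norml qf andbT lerNl -qN -[`|x|]normrN qf.
exists g => // y; rewrite gq; apply/eqP; rewrite eq_le qfy/=.
by have := qfy (- y); rewrite -[val (- y)]/(- val y) qN dualNr lerN2.
Qed.

(** * Non-unique extensions, and lifting through M-ideals *)

(** The restriction of [d] to the embedded [Y] attains its norm at [y] and has two norm-one
    extensions: evaluation at [d] and the limit [E] of evaluations at [ev t]. They differ at [F], as
    [E F = 0]. *)
Lemma not_wU_of_limit {R : realType} {Z : normedModType R} (Y : submodClosed Z)
    {T : Type} {U : set_system T} (PU : ProperFilter U) (ev : T -> dual Z)
    (d : dual Z) (y : Z) (F : bidual Z) :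
  (forall t, `|ev t| <= 1) -> `|d| <= 1 ->
  y \in Y -> `|y| <= 1 -> `|d y| = 1 ->
  (forall z, z \in Y -> (fun t => ev t z) @ U --> d z) ->
  (\forall t \near U, F (ev t) = 0) -> F d <> 0 ->
  ~ property_wU (in_bidual Y).
Proof.
move=> ev1 d1 Yy y1 dy evd Fev Fd wU.
have [G [UG sUG]] := ultraFilterLemma PU.
have PG : ProperFilter G := ultra_proper.
have [|/= E E1 Elim] := bidual_ultralim UG ev; first exact: nearW.
have EF : E F = 0.
  have FG : \forall t \near G, F (ev t) = 0 by exact: sUG.
  apply/eqP; rewrite eq_le; apply/andP; split.
    by apply: (cvgr_to_le (Elim F)); apply: filterS FG => t ->.
  by apply: (cvgr_to_ge (Elim F)); apply: filterS FG => t ->.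
have Ez z : z \in Y -> E (canonical_embedding z) = d z.
  move=> Yz; apply: (cvg_unique _ (Elim (canonical_embedding z))) => //.
  exact: cvg_trans (cvg_app _ sUG) (evd z Yz).
have [f fE f1] := dual_restrict (in_bidual Y) (canonical_embedding d).
have Yy' : canonical_embedding y \in in_bidual Y by apply/asboolP; exists y.
pose y' : sub_normed (in_bidual Y) := exist _ (canonical_embedding y) Yy'.
have y'1 : `|y'| <= 1 := le_trans (canonical_embedding_norm_le y) y1.
have fy : `|f y'| = 1 by rewrite fE !canonical_embeddingE.
have fn : `|f| = 1.
  apply/eqP; rewrite eq_le; apply/andP; split.
    exact: le_trans f1 (le_trans (canonical_embedding_norm_le d) d1).
  by rewrite -fy; exact: dual_ball_le.
have ext (g : dual (bidual Z)) : `|g| <= 1 ->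
    (forall z, z \in Y -> g (canonical_embedding z) = d z) ->
    norm_preserving_extension f g.
  move=> g1 gz; have gf y0 : g (val y0) = f y0.
    have /asboolP[z Yz zE] := valP y0.
    by rewrite fE zE canonical_embeddingE gz.
  split=> //; apply/eqP; rewrite fn eq_le g1/= -fy -gf.
  exact: dual_ball_le.
have [|g [_ gu]] := wU f; first by exists y' => //; rewrite fy fn.
have := gu _ (ext E E1 Ez); rewrite (gu (canonical_embedding d)) => [dE|].
  by apply: Fd; rewrite -EF -dE.
by apply: ext => //; exact: le_trans (canonical_embedding_norm_le d) d1.
Qed.

(** Each [g] on [J] has exactly one extension in [W]: the [W] component of a Hahn-Banach extension,
    unique because [W] meets the annihilator in 0. This lifting [P] is linear and contractive, and
    [F'] is [F] composed with it. *)
Lemma M_ideal_bidual_lift {R : realType} {Z : normedModType R}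
    (J : submodClosed Z) (W : submodClosed (dual Z)) :
  l1_direct_sum (annihilator J) [set` W] ->
  forall F : bidual Z, exists F' : bidual (sub_normed J),
    forall (w : dual Z) (g : dual (sub_normed J)), w \in W ->
      (forall j, g j = w (val j)) -> F' g = F w.
Proof.
move=> [dec int add] F.
have lift (g : dual (sub_normed J)) :
    {w : dual Z | [/\ w \in W, forall j, w (val j) = g j & `|w| <= `|g|]}.
  apply: cid; have [h hg hn] := hahn_banach _ g.
  have [u [v [Ju Wv huv]]] := dec h; exists v; split=> //.
    by move=> j; rewrite -hg huv dualD (Ju _ (valP j)) add0r.
  by rewrite (le_trans _ hn)// huv add// lerDr.
pose P g := sval (lift g).
have PW g : P g \in W by rewrite /P; case: (lift g) => w [].
have Pg (g : dual (sub_normed J)) j : P g (val j) = g j.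
  by rewrite /P; case: (lift g) => w [].
have Pn g : `|P g| <= `|g| by rewrite /P; case: (lift g) => w [].
have Pu (w : dual Z) (g : dual (sub_normed J)) :
    w \in W -> (forall j, g j = w (val j)) -> P g = w.
  move=> Ww gw; apply/eqP; rewrite -subr_eq0; apply/eqP.
  have : (annihilator J `&` [set` W]) (P g - w).
    split; last by rewrite /= -[- w]scaleN1r rpredD ?rpredZ.
    move=> x Jx; rewrite dualB (Pg g (exist _ x Jx)) gw subrr//.
  by rewrite int.
have [| |F' F'E _] := @make_dual R (dual (sub_normed J)) (fun g => F (P g)) `|F|
  (normr_ge0 F).
- move=> a g h; rewrite -dual_lin; congr (F _); apply: Pu.
    by rewrite rpredD// rpredZ.
  by move=> j; rewrite !dualD !dualZ !Pg.
- by move=> g; rewrite (le_trans (dual_le _ _))// ler_wpM2l.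
by exists F' => w g Ww gw; rewrite F'E (Pu w).
Qed.

(** If both components are nonzero, [d] is a proper convex combination of multiples of them, and
    extremality makes [d] the multiple of [u]. *)
Lemma extreme_l1_sum {R : realType} {V : normedModType R} (A B : set V)
    (d : V) :
  (forall (a : R) u, A u -> A (a *: u)) -> l1_direct_sum A B ->
  extreme_points unit_ball d -> A d \/ B d.
Proof.
move=> AZ [dec _ add] [d1 dext].
have [u [v [Au Bv duv]]] := dec d.
have [u0|u0] := eqVneq u 0; first by right; rewrite duv u0 add0r.
have [v0|v0] := eqVneq v 0; first by left; rewrite duv v0 addr0.
left; have un : 0 < `|u| by rewrite normr_gt0.
have vn : 0 < `|v| by rewrite normr_gt0.
have uv1 : `|u| + `|v| <= 1 by rewrite -add// -duv.
have u1 : 0 < 1 - `|u| by lra.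
(* The second weight is [1 - |u|] rather than [|v|], so the weights sum to 1 without knowing
   [|d| = 1]; [|v| <= 1 - |u|] keeps the second point in the ball. *)
have [||||<- _] := dext (`|u|^-1 *: u) ((1 - `|u|)^-1 *: v) `|u|.
- by rewrite /unit_ball/= normrZ normfV normr_id mulVf// gt_eqF.
- rewrite /unit_ball/= normrZ normfV (gtr0_norm u1) ler_pdivrMl// mulr1; lra.
- by rewrite un; lra.
- by rewrite !scalerA !divff ?scale1r// gt_eqF.
- exact: AZ.
Qed.

(** * The space [C0] and its evaluations *)

Lemma C0_continuous {R : realType} {L : topologicalType} (f : C0 R L) :
  continuous (f : L -> R).
Proof. by have /asboolP[] := valP f. Qed.

Lemma C0_compact {R : realType} {L : topologicalType} (f : C0 R L) (e : R) :
  0 < e -> compact [set x | e <= `|f x|].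
Proof. by have /asboolP[_] := valP f; apply. Qed.

Lemma C0_le_norm {R : realType} {L : topologicalType} (f : C0 R L) x :
  `|f x| <= `|f|.
Proof. exact: sup_norm_ub. Qed.

Lemma C0_norm_le {R : realType} {L : topologicalType} (f : C0 R L) M :
  0 <= M -> (forall x, `|f x| <= M) -> `|f| <= M.
Proof. exact: sup_norm_le. Qed.

Lemma C0D {R : realType} {L : topologicalType} (f g : C0 R L) x :
  (f + g : C0 R L) x = f x + g x.
Proof. by []. Qed.

Lemma C0N {R : realType} {L : topologicalType} (f : C0 R L) x :
  (- f : C0 R L) x = - f x.
Proof. by []. Qed.

Lemma C0Z {R : realType} {L : topologicalType} a (f : C0 R L) x :
  (a *: f : C0 R L) x = a * f x.
Proof. by []. Qed.

Lemma C0_sum {R : realType} {L : topologicalType} (I : Type) (r : seq I)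
    (f : I -> C0 R L) x : (\sum_(i <- r) f i : C0 R L) x = \sum_(i <- r) f i x.
Proof.
elim: r => [|i r IH]; first by rewrite !big_nil.
by rewrite !big_cons C0D IH.
Qed.

Lemma make_C0 {R : realType} {L : topologicalType} (f : L -> R) :
  continuous f ->
  (forall e : R, 0 < e ->
    exists2 K, compact K & [set x | e <= `|f x|] `<=` K) ->
  exists g : C0 R L, forall x, g x = f x.
Proof.
move=> cf vf; have fC : (f : L -> R^o) \in @C0_pred R L.
  apply/asboolP; split=> // e e0; have [K cK fK] := vf e e0.
  by apply: subclosed_compact cK fK; exact: closed_ge_norm.
by exists (exist _ (f : L -> R^o) fC).
Qed.

Lemma C0_mul {R : realType} {L : topologicalType} (p : L -> R) (f : C0 R L) :
  continuous p -> (forall x, `|p x| <= 1) ->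
  exists g : C0 R L, forall x, g x = p x * f x.
Proof.
move=> cp p1; apply: make_C0.
  by move=> x; apply: cvgM; [exact: cp|exact: C0_continuous].
move=> e e0; exists [set x | e <= `|f x|]; first exact: C0_compact.
by move=> x /= /le_trans; apply; rewrite normrM ler_piMl.
Qed.

Lemma C0_abs {R : realType} {L : topologicalType} (f : C0 R L) :
  exists g : C0 R L, forall x, g x = `|f x|.
Proof.
apply: make_C0; first by move=> x; apply: cvg_norm; exact: C0_continuous.
move=> e e0; exists [set x | e <= `|f x|]; first exact: C0_compact.
by move=> x /=; rewrite normr_id.
Qed.

(** The set where [|f x| >= |f| / 2] is nonempty and compact, and a maximum over it is global. *)
Lemma C0_attains {R : realType} {L : topologicalType} (f : C0 R L) :
  f != 0 -> exists x, `|f x| = `|f|.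
Proof.
move=> f0; have nf : 0 < `|f| by rewrite normr_gt0.
have nf2 : 0 < `|f| / 2 by rewrite divr_gt0.
have [x fx] : exists x, `|f| / 2 <= `|f x|.
  apply/not_existsP => H.
  have : `|f| <= `|f| / 2.
    apply: C0_norm_le => [|x]; first exact: ltW.
    by have /negP := H x; rewrite -ltNge => /ltW.
  by lra.
have [|||c _ cM] := @compact_EVT_max L R (fun x => `|f x|)
  [set x | `|f| / 2 <= `|f x|].
- by exists x.
- exact: C0_compact.
- by apply: continuous_subspaceT => y; apply: cvg_norm; exact: C0_continuous.
exists c; apply/eqP; rewrite eq_le C0_le_norm/=.
apply: C0_norm_le => // y; have [yK|yK] := leP (`|f| / 2) `|f y|.
  by apply: cM; rewrite inE.
by apply: (le_trans (ltW yK)); apply: (le_trans fx); apply: cM; rewrite inE.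
Qed.

Lemma C0_eval_in_dual {R : realType} {L : topologicalType} (x : L) :
  (fun f : C0 R L => f x : R^o) \in dual_pred (C0 R L : normedModType R).
Proof.
have [||d dE _] := @make_dual R (C0 R L) (fun f : C0 R L => f x) 1 ler01.
- by [].
- by move=> f; rewrite mul1r; exact: C0_le_norm.
have -> : (fun f : C0 R L => f x : R^o) = (val d : C0 R L -> R^o).
  by apply/funext => f; rewrite -dE.
exact: valP d.
Qed.

Definition delta (R : realType) {L : topologicalType} (x : L) :
    dual (C0 R L : normedModType R) :=
  exist _ (fun f : C0 R L => f x : R^o) (C0_eval_in_dual x).

Lemma deltaE {R : realType} {L : topologicalType} (x : L) (f : C0 R L) :
  delta R x f = f x.
Proof. by []. Qed.

Lemma delta_norm_le {R : realType} {L : topologicalType} (x : L) :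
  `|delta R x| <= 1.
Proof.
by apply: norm_dual_le => f f1; rewrite deltaE (le_trans (C0_le_norm f x)).
Qed.

(** * Bump functions and extremality of evaluations *)

(** Complete regularity separates [x] from the complement of the interior of [U] intersected with a
    compact neighbourhood [K]; [K] also ensures vanishing at infinity. *)
Lemma C0_bump {R : realType} {L : topologicalType} (x : L) (U : set L) :
  locally_compact [set: L] -> hausdorff_space L -> nbhs x U ->
  exists p : C0 R L, [/\ p x = 1, forall y, 0 <= p y <= 1 &
    forall y, ~ U y -> p y = 0].
Proof.
move=> lcL hL xU.
have [K xK [cK clK]] : exists2 K, nbhs x K & compact K /\ closed K.
  have [K nK cK] := lcL x I; exists K => //.
  have : nbhs x [set y | setT y -> K y] by exact: nK.
  by apply: filterS => y; exact.
have crL := @locally_compact_completely_regular L R lcL hL.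
have oV : open ((U `&` K)°) by exact: open_interior.
have [||f [cf f01 fx f1]] := (@uniform_separatorP _ R _ _).1
  (crL x (~` (U `&` K)°) _ _).
- exact: open_closedC.
- by move=> /(_ (filterI xU xK)).
have r01 y : 0 <= f y <= 1.
  by have /f01 /= : range f (f y) by exists y; rewrite //; rewrite in_itv.
have fU y : ~ (U `&` K) y -> f y = 1.
  move=> nU; apply: f1; exists y => // /interior_subset; exact: nU.
have [||p pE] := @make_C0 R L (fun y => 1 - f y).
- by move=> y; apply: cvgB; [exact: cvg_cst|exact: cf].
- move=> e e0; exists K => // y /=.
  have [[_ Ky]//|/fU ->] := pselect ((U `&` K) y).
  by rewrite subrr normr0 leNgt e0.
exists p; split=> [|y|y nU]; rewrite pE.
- by rewrite (fx (f x)) ?subr0//; exists x.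
- by have := r01 y; lra.
- by rewrite fU ?subrr// => -[].
Qed.

(** Here [p] is only continuous with values in [[0, 1]]; it enters [C0] later through products with
    functions of [C0]. *)
Lemma finite_separation {R : realType} {L : topologicalType} (S T : seq L) :
  locally_compact [set: L] -> hausdorff_space L ->
  (forall x, x \in S -> x \notin T) ->
  exists p : L -> R, [/\ continuous p, forall y, 0 <= p y <= 1,
    forall x, x \in S -> p x = 1 & forall x, x \in T -> p x = 0].
Proof.
move=> lcL hL; have crL := @locally_compact_completely_regular L R lcL hL.
elim: S => [_|s S IH dST].
  exists (fun=> 0); split=> //; last by move=> y; rewrite lexx ler01.
  by move=> x; exact: cvg_cst.
have [|p [cp p01 pS pT]] := IH.
  by move=> x xS; apply: dST; rewrite inE xS orbT.
have sT : s \notin T by apply: dST; rewrite inE eqxx.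
have [||f [cf f01 fs fT]] := (@uniform_separatorP _ R _ _).1
  (crL s [set` T] _ _).
- apply: (accessible_finite_set_closed.1 (hausdorff_accessible hL)).
  exact: finite_seq.
- by apply/negP.
have r01 y : 0 <= f y <= 1.
  by have /f01 /= : range f (f y) by exists y; rewrite //; rewrite in_itv.
(* [f] is 0 at [s] and 1 on [T], so the new function is 1 where [p = 1] or [f = 0], and stays 0 on
   [T]. *)
exists (fun y => 1 - (1 - p y) * f y); split.
- move=> y; apply: cvgB; first exact: cvg_cst.
  by apply: cvgM; [apply: cvgB; [exact: cvg_cst|exact: cp]|exact: cf].
- by move=> y; have /andP[? ?] := r01 y; have /andP[? ?] := p01 y; nra.
- move=> x; rewrite inE => /orP[/eqP ->|/pS ->].
    by rewrite (fs (f s)) ?mulr0 ?subr0//; exists s.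
  by rewrite subrr mul0r subr0.
- by move=> x xT; rewrite (pT _ xT) (fT (f x)) ?subr0 ?mulr1 ?subrr//; exists x.
Qed.

Lemma convex_unit_max {R : realType} (t a b : R) :
  0 < t < 1 -> a <= 1 -> b <= 1 -> 1 = t * a + (1 - t) * b -> a = 1.
Proof.
move=> /andP[t0 t1] a1 b1 e; apply/eqP; rewrite eq_le a1/=.
by rewrite leNgt; apply/negP => a1'; nra.
Qed.

(** In a convex splitting of [delta R x], a part [g] is 1 at every bump peaking at [x]. If [f x = 0]
    and [|f| <= 1], adding [f] to a bump living where [|f y| < e] keeps the norm at most [1 + e], so
    [g f <= e]. Thus [g f] depends on [f x] only. *)
Lemma delta_extreme {R : realType} {L : topologicalType} (x : L) :
  locally_compact [set: L] -> hausdorff_space L ->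
  extreme_points unit_ball (delta R x).
Proof.
move=> lcL hL.
suff half (g h : dual (C0 R L)) (t : R) : `|g| <= 1 -> `|h| <= 1 ->
    0 < t < 1 -> delta R x = t *: g + (1 - t) *: h -> g = delta R x.
  split=> [|g h t g1 h1 t01 dgh]; first exact: delta_norm_le.
  split; first exact: half dgh.
  apply: (half h g (1 - t)) => //; first by lra.
  by rewrite dgh addrC (_ : 1 - (1 - t) = t)//; lra.
move=> g1 h1 t01 dgh.
have dE (f : C0 R L) : f x = t * g f + (1 - t) * h f.
  by rewrite -deltaE dgh dualD !dualZ.
have le1 (q : dual (C0 R L)) (f : C0 R L) M :
    `|q| <= 1 -> `|f| <= M -> q f <= M.
  move=> q1 fM; apply: (le_trans (ler_norm _)).
  exact: le_trans (unit_dual_le q f q1) fM.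
have bump1 (p : C0 R L) : p x = 1 -> (forall y, 0 <= p y <= 1) -> g p = 1.
  move=> px p01; have p1 : `|p| <= 1.
    apply: C0_norm_le => // y; have /andP[? ?] := p01 y.
    by rewrite ger0_norm.
  apply: (convex_unit_max t _ (h p)) => //; [exact: le1|exact: le1|].
  by rewrite -dE.
have g0 (f : C0 R L) : f x = 0 -> `|f| <= 1 -> g f = 0.
  move=> fx f1.
  suff le (f' : C0 R L) e : f' x = 0 -> `|f'| <= 1 -> 0 < e -> g f' <= e.
    apply/eqP; rewrite eq_le; apply/andP; split.
      by apply/ler_addgt0Pl => e e0; rewrite addr0; exact: le.
    rewrite -oppr_le0 -dualNr; apply/ler_addgt0Pl => e e0; rewrite addr0.
    by apply: le; rewrite ?C0N ?fx ?oppr0 ?normrN.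
  move=> f'x f'1 e0.
  have [|p [px p01 p0]] := @C0_bump R L x [set y | `|f' y| < e] lcL hL.
    have /cvgrPdist_lt/(_ e e0) := C0_continuous f' x.
    by rewrite f'x; apply: filterS => y /=; rewrite sub0r normrN.
  have := bump1 p px p01; suff : g (p + f') <= 1 + e by rewrite dualDr; lra.
  apply: le1 => //; apply: C0_norm_le => [|y]; first by lra.
  have /andP[p0y p1y] := p01 y.
  have [fe|fe] := ltP `|f' y| e.
    rewrite C0D (le_trans (ler_normD _ _))// (ger0_norm p0y); lra.
  rewrite C0D p0 ?add0r; last by move=> /=; rewrite ltNge fe.
  have := C0_le_norm f' y; lra.
have [p [px p01 _]] := @C0_bump R L x setT lcL hL filterT.
suff gE (f : C0 R L) : g f = f x by exact: dual_ext.
pose k : C0 R L := f - f x *: p.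
have kx : k x = 0 by rewrite /k C0D C0N C0Z px; lra.
have k1 : 0 < `|k| + 1 by rewrite ltr_wpDl.
have : g ((`|k| + 1)^-1 *: k) = 0.
  apply: g0; first by rewrite C0Z kx mulr0.
  by rewrite normrZ normfV (gtr0_norm k1) ler_pdivrMl// mulr1 lerDl.
rewrite dualZr => /eqP; rewrite mulf_eq0 invr_eq0 gt_eqF//= => /eqP.
by rewrite /k dualBr dualZr (bump1 p)//; lra.
Qed.

(** * Isolated and non-isolated points *)

(** The indicator [e] of the open and closed point is in [C0], and [h - h x *: e] is [h] reset to 0
    at [x]. *)
Lemma isolated_M_line {R : realType} {L : topologicalType} (x : L) :
  hausdorff_space L -> isolated [set: L] x ->
  exists e : C0 R L, M_line e (delta R x).
Proof.
move=> hL [_ [V nV VE]].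
have ox : open [set x].
  rewrite openE => _ ->; rewrite /interior -VE setIT; exact: nV.
have cx : closed [set x].
  by apply: accessible_closed_set1; exact: hausdorff_accessible.
have [||e eE] := @make_C0 R L (fun y => (y == x)%:R).
- move=> y; apply: cvg_near_cst; have [->|yx] := eqVneq y x.
    have : nbhs x [set x] by apply: open_nbhs_nbhs.
    by apply: filterS => z /= ->; rewrite eqxx.
  have : nbhs y (~` [set x]).
    apply: open_nbhs_nbhs; split; first exact: closed_openC.
    by move=> /= yx'; rewrite yx' eqxx in yx.
  by apply: filterS => z /= /eqP/negPf ->.
- move=> c c0; exists [set x]; first exact: compact_set1.
  move=> y /=; have [->//|yx] := eqVneq y x.
  by rewrite normr0 leNgt c0.
exists e; split; first by rewrite deltaE eE eqxx.
suff hE (h : C0 R L) : `|h| = Num.max `|h x| `|h - h x *: e| by [].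
apply/eqP; rewrite eq_le; apply/andP; split.
  apply: C0_norm_le => [|y]; first by rewrite le_max normr_ge0.
  have [->|yx] := eqVneq y x; first by rewrite le_max lexx.
  rewrite le_max; apply/orP; right; apply: le_trans (C0_le_norm _ y).
  by rewrite C0D C0N C0Z eE (negPf yx) mulr0 subr0.
rewrite ge_max C0_le_norm/=; apply: C0_norm_le => // y.
rewrite C0D C0N C0Z eE; have [->|yx] := eqVneq y x.
  by rewrite mulr1 subrr normr0.
by rewrite mulr0 subr0 C0_le_norm.
Qed.

(** Deleting from [U] the finitely many points of [S] other than [x] leaves a neighbourhood of [x],
    which contains another point. *)
Lemma not_isolated_avoid {L : topologicalType} (x : L) (U : set L) (S : seq L) :
  hausdorff_space L -> ~ isolated [set: L] x -> nbhs x U ->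
  exists2 y, U y & (y != x) && (y \notin S).
Proof.
move=> hL nx xU.
pose T := [seq y <- S | y != x].
have clT : closed [set` T].
  apply: (accessible_finite_set_closed.1 (hausdorff_accessible hL)).
  exact: finite_seq.
have nT : nbhs x (U `&` ~` [set` T]).
  apply: filterI => //; apply: open_nbhs_nbhs; split; first exact: closed_openC.
  by rewrite /= mem_filter eqxx.
apply: contrapT => H; apply: nx; split; first exact: mem_set.
exists (U `&` ~` [set` T]) => //; rewrite setIT; apply/seteqP; split=> y.
  move=> [Uy nTy]; apply: contrapT => /eqP yx; apply: H; exists y => //.
  rewrite yx/=; apply/negP => yS; apply: nTy.
  by rewrite /= mem_filter yx.
by move=> ->; exact: nbhs_singleton.
Qed.

(** * Partitions of unity and approximation by evaluations *)

(** Compactness in near-covering form, along the filter of finite lists of points of [K] ordered by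
    inclusion. *)
Lemma compact_finite_cover {L : topologicalType} (K : set L) (V : L -> set L) :
  compact K -> (forall x, K x -> nbhs x (V x)) ->
  exists r : seq L, (forall x, x \in r -> K x) /\
    forall y, K y -> exists2 x, x \in r & V x y.
Proof.
move=> /compact_near_coveringP cK KV.
pose F := filter_from [set r : seq L | forall x, x \in r -> K x]
  (fun r => [set r' : seq L | {subset r <= r'}]).
have FF : Filter F.
  apply: filter_from_filter; first by exists [::].
  move=> r r' Kr Kr'; exists (r ++ r').
    by move=> x; rewrite mem_cat => /orP[/Kr|/Kr'].
  move=> r'' rr; split=> x xr; apply: rr; by rewrite mem_cat xr ?orbT.
have [|r Kr rP] := cK _ F (fun r y => exists2 x, x \in r & V x y) FF.
  move=> x Kx; exists (V x, [set r' : seq L | {subset [:: x] <= r'}]) => /=.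
    split; first exact: KV.
    by exists [:: x] => // y; rewrite inE => /eqP ->.
  by move=> [y r] /= [Vxy xr]; exists x => //; apply: xr; rewrite inE.
by exists r; split=> // y Ky; exact: (rP r _ y Ky).
Qed.

(* The partition is the normalisation of the tent functions
   max(0, 2 c - osc x), so no appeal to Urysohn's lemma is needed. *)
Lemma oscillation_partition {R : realType} {L : topologicalType}
    (s : seq (C0 R L)) (e : R) : 0 < e ->
  exists (r : seq L) (p : L -> C0 R L), [/\
    forall x y, 0 <= p x y,
    forall y, \sum_(x <- r) p x y <= 1,
    forall (h : C0 R L) x y, h \in s -> x \in r -> p x y != 0 ->
      `|h x - h y| <= e &
    forall (h : C0 R L) y, h \in s -> \sum_(x <- r) p x y != 1 -> `|h y| <= e].
Proof.
(* Nodes will satisfy [N x >= 3 * c] and [psi x] will live where [osc x < 2 * c], hence within the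
   compact set where [N >= c]. *)
move=> e0; pose c := e / 3; have c0 : 0 < c by rewrite divr_gt0.
pose osc x y := \sum_(h <- s) `|h x - h y|.
have osc_ge (h : C0 R L) x y : h \in s -> `|h x - h y| <= osc x y.
  by move=> hs; rewrite /osc (big_rem h)//= lerDl sumr_ge0.
have [N NE] : exists N : C0 R L, forall y, N y = \sum_(h <- s) `|h y|.
  have [a aE] := choice (@C0_abs R L).
  by exists (\sum_(h <- s) a h) => y; rewrite C0_sum; apply: eq_bigr => h _.
have N0 y : 0 <= N y by rewrite NE sumr_ge0.
have N_ge (h : C0 R L) y : h \in s -> `|h y| <= N y.
  by move=> hs; rewrite NE (big_rem h)//= lerDl sumr_ge0.
have Nosc x y : N x <= N y + osc x y.
  rewrite !NE -big_split/=; apply: ler_sum => h _.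
  by rewrite -{1}[h x](subrK (h y)) (le_trans (ler_normD _ _))// addrC.
have osc_cont x : continuous (osc x).
  move=> y; rewrite /osc; apply: cvg_big => //; first exact: add_continuous.
  move=> h _; apply: cvg_norm; apply: cvgB; first exact: cvg_cst.
  exact: C0_continuous.
pose K := [set y | e <= `|N y|].
have KN y : K y -> e <= N y by rewrite /K/= ger0_norm.
have [||r [rK rV]] := @compact_finite_cover L K
  (fun x => [set y | osc x y < c]) _ _.
- exact: C0_compact.
- move=> x _; have /cvgrPdist_lt/(_ c c0) := osc_cont x x.
  apply: filterS => y /=; rewrite [X in `|X - _|](_ : osc x x = 0).
    by rewrite sub0r normrN; apply: le_lt_trans; exact: ler_norm.
  by rewrite /osc big1// => h _; rewrite subrr normr0.
pose psi x y := Num.max 0 (2 * c - osc x y).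
have psi0 x y : 0 <= psi x y by rewrite le_max lexx.
have psi_cont x : continuous (psi x).
  move=> y; apply: (@continuous_max R L (cst 0) (fun y => 2 * c - osc x y)).
    exact: cvg_cst.
  by apply: cvgB; [exact: cvg_cst|exact: osc_cont].
have psi_osc x y : psi x y != 0 -> osc x y < 2 * c.
  move=> p0; rewrite ltNge; apply: contra_neqN p0 => ?.
  by rewrite /psi max_l// subr_le0.
pose Psi y := \sum_(x <- r) psi x y.
have Psi_cont : continuous Psi.
  move=> y; apply: cvg_big => //; first exact: add_continuous.
  by move=> x _; exact: psi_cont.
(* The lower bound [c] keeps the denominator positive. Where [N > e], some node has [osc < c], so
   [Psi >= c] and the sum is exactly 1. *)
pose den y := Num.max c (Psi y).
have den_ge y : c <= den y by rewrite le_max lexx.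
have den0 y : 0 < den y by exact: lt_le_trans (den_ge y).
have den_cont : continuous den.
  move=> y; apply: (@continuous_max R L (cst c) Psi); first exact: cvg_cst.
  exact: Psi_cont.
have [p pE] : exists p : L -> C0 R L,
    forall x, x \in r -> forall y, p x y = psi x y / den y.
  have ex x : exists p : C0 R L, x \in r -> forall y, p y = psi x y / den y.
    have [xr|xr] := boolP (x \in r); last by exists 0.
    have [||p pE] := @make_C0 R L (fun y => psi x y / den y); last by exists p.
      move=> y; apply: cvgM; first exact: psi_cont.
      by apply: cvgV; [rewrite gt_eqF|exact: den_cont].
    move=> a a0; exists [set y | c <= `|N y|]; first exact: C0_compact.
    move=> y /= ay; rewrite ger0_norm//.
    have : osc x y < 2 * c.
      apply: psi_osc; apply/eqP => psi0'; move: ay.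
      by rewrite psi0' mul0r normr0 leNgt a0.
    have := KN _ (rK x xr); have := Nosc x y; rewrite /c; lra.
  by have [p pP] := choice ex; exists p.
have sumE y : \sum_(x <- r) p x y = Psi y / den y.
  rewrite /Psi mulr_suml !big_seq; apply: eq_bigr => x xr; exact: pE.
(* Setting [p' x] to 0 off [r] makes nonnegativity hold for all [x]. *)
pose p' x : C0 R L := if x \in r then p x else 0.
have p'p y : \sum_(x <- r) p' x y = Psi y / den y.
  by rewrite -sumE !big_seq; apply: eq_bigr => x xr; rewrite /p' xr.
exists r, p'; split.
- move=> x y; rewrite /p'; case: ifP => // xr.
  by rewrite pE// divr_ge0// ltW.
- by move=> y; rewrite p'p ler_pdivrMr// mul1r le_max lexx orbT.
- move=> h x y hs xr; rewrite /p' xr pE// => pn0.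
  have : osc x y < 2 * c.
    by apply: psi_osc; apply: contraNneq pn0 => ->; rewrite mul0r.
  have := osc_ge h x y hs; rewrite /c; lra.
- move=> h y hs; rewrite p'p => S1; apply: le_trans (N_ge h y hs) _.
  rewrite leNgt; apply/negP => eN; move/eqP: S1; apply.
  have [x xr oxy] : exists2 x, x \in r & osc x y < c.
    by apply: rV; rewrite /K/= ger0_norm// ltW.
  have cP : c <= Psi y.
    rewrite /Psi (big_rem x)//=; apply: ler_wpDr; first by rewrite sumr_ge0.
    by rewrite /psi le_max; apply/orP; right; lra.
  by rewrite /den max_r// divff// gt_eqF// (lt_le_trans c0).
Qed.

(** The approximant is the sum of [f (p x) *: delta R (sh x)], where the functions of [s] oscillate
    little on each [p x] and [sh] moves every node off [S], so that [F d = 0]. *)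
Lemma delta_combinations_dense {R : realType} {L : topologicalType}
    (f : dual (C0 R L : normedModType R))
    (F : bidual (C0 R L : normedModType R))
    (S : seq L) (s : seq (C0 R L)) (e : R) :
  hausdorff_space L -> (forall x : L, ~ isolated [set: L] x) ->
  `|f| <= 1 -> (forall x, x \notin S -> F (delta R x) = 0) -> 0 < e ->
  exists d : dual (C0 R L : normedModType R),
    [/\ `|d| <= 1, F d = 0 & forall h : C0 R L, h \in s -> `|d h - f h| < e].
Proof.
move=> hL niso f1 FS e0; pose c := e / 3; have c0 : 0 < c by rewrite divr_gt0.
have [r [p [p0 p1 posc pout]]] := oscillation_partition s c c0.
have [x|sh shP] := @choice _ _ (fun x y : L => y \notin S /\
    forall h : C0 R L, h \in s -> `|h x - h y| <= c).
  have nU : nbhs x [set y | forall h : C0 R L, h \in s -> `|h x - h y| <= c].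
    elim: s {posc pout} => [|k s IH]; first exact: filterE.
    have /cvgrPdist_le/(_ c c0) := C0_continuous k x.
    apply: filterS2 IH => y ys /= kx h.
    by rewrite inE => /orP[/eqP ->//|]; exact: ys.
  have [y Uy /andP[_ yS]] := not_isolated_avoid x _ S hL (niso x) nU.
  by exists y.
pose d : dual (C0 R L : normedModType R) :=
  \sum_(x <- r) f (p x) *: delta R (sh x).
have dE (h : C0 R L) : d h = f (\sum_(x <- r) h (sh x) *: p x).
  rewrite dual_sum dual_sumr; apply: eq_bigr => x _.
  by rewrite dualZ dualZr deltaE mulrC.
exists d; split.
- apply: norm_dual_le => h h1; rewrite /d dual_sum.
  apply: le_trans (ler_norm_sum _ _ _) _.
  (* Choosing signs turns the sum of the [|f (p x)|] into [f] at a function of norm at most 1. *)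
  apply: (@le_trans _ _ (f (\sum_(x <- r) Num.sg (f (p x)) *: p x))).
    rewrite dual_sumr; apply: ler_sum => x _.
    rewrite dualZ dualZr deltaE normrM.
    by rewrite -normrEsg ler_piMr// (le_trans (C0_le_norm _ _)).
  apply: le_trans (ler_norm _) _; apply: le_trans (unit_dual_le f _ f1) _.
  apply: C0_norm_le => // y; rewrite C0_sum (le_trans _ (p1 y))//.
  apply: le_trans (ler_norm_sum _ _ _) _; apply: ler_sum => x _.
  rewrite C0Z normrM (ger0_norm (p0 x y)) ler_piMl//.
  by rewrite normr_sg; case: (_ != 0).
- rewrite dual_sumr big1// => x _; rewrite dualZr FS ?mulr0//.
  by have [] := shP x.
- move=> h hs; rewrite dE -dualBr.
  (* One [c] is lost to oscillation, one to moving the node, and [2 * c < e]. *)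
  apply: (@le_lt_trans _ _ (2 * c)); last by rewrite /c; lra.
  apply: le_trans (unit_dual_le f _ f1) _.
  apply: C0_norm_le => [|y]; first by rewrite mulr_ge0// ltW.
  rewrite C0D C0N C0_sum; set P := \sum_(x <- r) p x y.
  (* Where the partition does not sum to 1, the leftover [(1 - P) * h y] is harmless because
     [|h y| <= c] there. *)
  have -> : \sum_(x <- r) (h (sh x) *: p x : C0 R L) y - h y =
      \sum_(x <- r) p x y * (h (sh x) - h y) - (1 - P) * h y.
    have -> : \sum_(x <- r) p x y * (h (sh x) - h y) =
        \sum_(x <- r) (h (sh x) *: p x : C0 R L) y - P * h y.
      rewrite /P mulr_suml -sumrB; apply: eq_bigr => x _.
      by rewrite C0Z; ring.
    by ring.
  have Pc : `|(1 - P) * h y| <= (1 - P) * c.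
    have P1 : 0 <= 1 - P by rewrite subr_ge0 p1.
    rewrite normrM (ger0_norm P1).
    have [P1'|P1'] := eqVneq P 1; first by rewrite P1' subrr !mul0r.
    by rewrite ler_wpM2l// pout.
  have Pd : `|\sum_(x <- r) p x y * (h (sh x) - h y)| <= P * (2 * c).
    apply: le_trans (ler_norm_sum _ _ _) _.
    rewrite /P mulr_suml big_seq [leRHS]big_seq; apply: ler_sum => x xr.
    rewrite normrM (ger0_norm (p0 x y)).
    have [->|pn0] := eqVneq (p x y) 0; first by rewrite !mul0r.
    rewrite ler_wpM2l//.
    have := posc h x y hs xr pn0; have := (shP x).2 h hs.
    have : `|h (sh x) - h y| <= `|h x - h (sh x)| + `|h x - h y|.
      rewrite [X in _ <= X + _]distrC.
      by rewrite -{1}(subrKA (h x)) ler_normD.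
    lra.
  have := p1 y; rewrite -/P => P1; apply: le_trans (ler_normB _ _) _.
  nra.
Qed.

(** * No points of continuity on the sphere *)

Lemma continuity_point_vanish {R : realType} {L : topologicalType}
    (f : dual (C0 R L : normedModType R))
    (F : bidual (C0 R L : normedModType R))
    (S : seq L) :
  hausdorff_space L -> (forall x : L, ~ isolated [set: L] x) ->
  `|f| <= 1 -> point_of_continuity f ->
  (forall x, x \notin S -> F (delta R x) = 0) -> F f = 0.
Proof.
move=> hL niso f1 cf FS.
apply: (point_of_continuity_vanish f
  [set d | `|d| <= 1 /\ F d = 0] F cf).
- by move=> d [].
- move=> s e e0.
  have [d [d1 Fd ds]] := delta_combinations_dense f F S s e hL niso f1 FS e0.
  by exists d.
- by move=> d [].
Qed.

Lemma sphere_not_continuity {R : realType} {L : topologicalType}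
    (f : dual (C0 R L : normedModType R)) :
  locally_compact [set: L] -> hausdorff_space L ->
  (forall x : L, ~ isolated [set: L] x) ->
  `|f| = 1 -> ~ point_of_continuity f.
Proof.
move=> lcL hL niso f1 cf.
suff [S [F [c [c0 cF FS]]]] : exists (S : seq L) (F : bidual (C0 R L)) (c : R),
    [/\ 0 < c, c <= F f & forall x, x \notin S -> F (delta R x) = 0].
  have := continuity_point_vanish f F S hL niso _ cf FS.
  by rewrite f1 => /(_ (lexx 1)) Ff; move: cF; rewrite Ff leNgt c0.
(* Either ball functions vanishing on any given finite set can keep [f h >= 1 / 2], and the empty
   [S] works; or some finite [S] prevents this. *)
have [H|/existsNP[S HS]] := pselect (forall S : seq L, exists h : C0 R L,
    [/\ `|h| <= 1, 1 / 2 <= f h & forall x, x \in S -> delta R x h = 0]).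
  have [|F [Ff F0]] := bidual_fip setT (delta R) f (1 / 2).
    by move=> s _; exact: H.
  by exists [::], F, (1 / 2); split=> // x _; exact: F0.
have [g g1 fg] : exists2 g : C0 R L, `|g| <= 1 & 3 / 4 < f g.
  apply: contrapT => H.
  have fle (g : C0 R L) : `|g| <= 1 -> f g <= 3 / 4.
    by move=> g1; rewrite leNgt; apply/negP => fg; apply: H; exists g.
  have : `|f| <= 3 / 4.
    apply: norm_dual_le => g g1; rewrite ler_norml fle// andbT lerNl -dualNr.
    by rewrite fle// normrN.
  by rewrite f1; lra.
(* With [p = 1] on [S], the function [g - p g] vanishes on [S], so [f] is below 1/2 at it;
   [f g > 3 / 4] then leaves more than 1/4 for [f] at [p g]. *)
have [|F [Ff F0]] := bidual_fip [set x | x \notin S] (delta R) f (1 / 4).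
  move=> T TS.
  have [|p [cp p01 pS pT]] := @finite_separation R L S T lcL hL.
    by move=> x xS; apply/negP => /TS /=; rewrite xS.
  have p1 y : `|p y| <= 1 by have /andP[? ?] := p01 y; rewrite ger0_norm.
  have [h hE] := C0_mul p g cp p1.
  exists h; split.
  - apply: C0_norm_le => // y; rewrite hE normrM.
    by rewrite mulr_ile1// (le_trans (C0_le_norm g y)).
  - have fgh : f (g - h) < 1 / 2.
      rewrite ltNge; apply/negP => fgh; apply: HS; exists (g - h); split=> //.
        apply: C0_norm_le => // y; rewrite C0D C0N hE.
        have -> : g y - p y * g y = (1 - p y) * g y by ring.
        have /andP[? ?] := p01 y.
        rewrite normrM mulr_ile1//; last by rewrite (le_trans (C0_le_norm g y)).
        by rewrite ger0_norm; lra.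
      by move=> x xS; rewrite deltaE C0D C0N hE pS// mul1r subrr.
    by move: fgh; rewrite dualBr; lra.
  - by move=> x xT; rewrite deltaE hE pT// mul0r.
by exists S, F, (1 / 4); split=> //; lra.
Qed.

(** * Failure of unique extension when no point is isolated *)

(** [F] is a limit of ball functions with value 1 at [x] that vanish on finite sets of other
    points. *)
Lemma delta_indicator {R : realType} {L : topologicalType} (x : L) :
  locally_compact [set: L] -> hausdorff_space L ->
  exists F : bidual (C0 R L : normedModType R),
    F (delta R x) <> 0 /\ forall t, t != x -> F (delta R t) = 0.
Proof.
move=> lcL hL.
have [|F [Fx F0]] := bidual_fip [set t | t != x] (delta R) (delta R x) 1.
  move=> T Tx.
  have [|p [cp p01 pS pT]] := @finite_separation R L [:: x] T lcL hL.
    by move=> t; rewrite inE => /eqP ->; apply/negP => /Tx /=; rewrite eqxx.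
  have [q [qx q01 _]] := @C0_bump R L x setT lcL hL filterT.
  have p1 y : `|p y| <= 1 by have /andP[? ?] := p01 y; rewrite ger0_norm.
  have [h hE] := C0_mul p q cp p1.
  exists h; split.
  - apply: C0_norm_le => // y; rewrite hE normrM mulr_ile1//.
    by have /andP[? ?] := q01 y; rewrite ger0_norm.
  - by rewrite deltaE hE qx pS ?inE// mulr1.
  - by move=> t tT; rewrite deltaE hE pT// mul0r.
by exists F; split=> // Fx0; move: Fx; rewrite Fx0; lra.
Qed.

Lemma punctured_proper {L : topologicalType} (x : L) :
  hausdorff_space L -> ~ isolated [set: L] x ->
  ProperFilter (within (fun t => t != x) (nbhs x)).
Proof.
move=> hL nx; apply: Build_ProperFilter_ex => U xU.
have [t Ut /andP[tx _]] := not_isolated_avoid x _ [::] hL nx xU.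
by exists t; exact: Ut.
Qed.

Lemma subspace_norming {R : realType} {L : topologicalType}
    (Y : submodClosed (C0 R L : normedModType R)) : nonzero_subspace Y ->
  exists (y : C0 R L) (x : L), [/\ y \in Y, `|y| = 1 & `|y x| = 1].
Proof.
move=> [y0 Yy0 y00]; have n0 : 0 < `|y0| by rewrite normr_gt0.
have [x xM] := C0_attains y0 y00.
exists (`|y0|^-1 *: y0), x; split; first by rewrite rpredZ.
  by rewrite normrZ normfV normr_id mulVf// gt_eqF.
by rewrite C0Z normrM xM normfV normr_id mulVf// gt_eqF.
Qed.

(** As [t] tends to [x] with [t != x], [delta R t] tends to [delta R x] at each function, while [F]
    kills every such [delta R t] but not [delta R x]. *)
Lemma subspace_not_wU {R : realType} {L : topologicalType}
    (Y : submodClosed (C0 R L : normedModType R)) :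
  locally_compact [set: L] -> hausdorff_space L ->
  (forall x : L, ~ isolated [set: L] x) ->
  nonzero_subspace Y -> ~ property_wU (in_bidual Y).
Proof.
move=> lcL hL niso /subspace_norming[y [x [Yy y1 yx]]].
have [F [Fx F0]] := @delta_indicator R L x lcL hL.
have PU := punctured_proper x hL (niso x).
apply: (not_wU_of_limit Y PU (delta R) (delta R x) y F) => //.
- by move=> t; exact: delta_norm_le.
- exact: delta_norm_le.
- by rewrite y1.
- move=> z _; apply: cvg_trans (C0_continuous z x).
  by apply: cvg_app; exact: cvg_within.
- by apply: (@filterE _ (nbhs x)) => t; exact: F0.
Qed.

(** The lift [F'] of [F] is known only at restrictions of elements of [W]. Evaluations are extreme,
    so each lies in [W] or annihilates [J]; the latter fails near [x], where [y t] is nonzero. *)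
Lemma M_ideal_not_smooth {R : realType} {L : topologicalType}
    (J : submodClosed (C0 R L : normedModType R)) :
  locally_compact [set: L] -> hausdorff_space L ->
  (forall x : L, ~ isolated [set: L] x) ->
  nonzero_subspace J -> M_ideal J -> ~ weakly_hahn_banach_smooth (sub_normed J).
Proof.
move=> lcL hL niso /subspace_norming[y [x [Jy y1 yx]]] [_ [W JW]].
have [F [Fx F0]] := @delta_indicator R L x lcL hL.
have PU := punctured_proper x hL (niso x).
have [F' F'E] := M_ideal_bidual_lift J W JW F.
have [t|ev evP] := @choice _ _ (fun (t : L) (d : dual (sub_normed J)) =>
    (forall j : sub_normed J, d j = (val j : C0 R L) t) /\ `|d| <= 1).
  have [g gE g1] := dual_restrict J (delta R t).
  by exists g; split=> //; exact: le_trans g1 (delta_norm_le t).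
have Wt t : y t <> 0 -> delta R t \in W.
  move=> yt; have [a u|ann|//] :=
    extreme_l1_sum (annihilator J) [set` W] _ _ JW (delta_extreme t lcL hL).
    by move=> Ju z Jz; rewrite dualZ Ju// mulr0.
  by have := ann y Jy; rewrite deltaE.
have F't t : y t <> 0 -> F' (ev t) = F (delta R t).
  by move=> /Wt Wt'; apply: F'E => // j; rewrite (evP t).1.
have yx0 : y x <> 0 by move=> yx0; move: yx; rewrite yx0 normr0; lra.
pose y' : sub_normed J := exist _ y Jy.
apply: (not_wU_of_limit (whole_space : submodClosed (sub_normed J)) PU
  ev (ev x) y' F') => //.
- by move=> t; have [] := evP t.
- by have [] := evP x.
- by rewrite -[`|y'|]/(`|y|) y1.
- by rewrite (evP x).1.
- move=> z _; have -> : (fun t => ev t z) = (val z : C0 R L).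
    by apply/funext => t; rewrite (evP t).1.
  rewrite (evP x).1; apply: cvg_trans (C0_continuous (val z : C0 R L) x).
  by apply: cvg_app; exact: cvg_within.
- have : nbhs x [set t | y t <> 0].
    have /cvgrPdist_lt/(_ _ ltr01) := C0_continuous y x.
    apply: filterS => t /= + yt; rewrite yt subr0 yx ltxx//.
  apply: (@filterS _ (nbhs x)) => t yt tx; by rewrite F't// F0.
- by rewrite F't.
Qed.

(** * Lines, and the cycle of implications *)

Definition line {R : realType} {V : normedModType R} (v : V) : {pred V} :=
  [pred x | `[< exists a : R, x = a *: v >]].

Lemma line_submod {R : realType} {V : normedModType R} (v : V) :
  subsemimod_closed (line v).
Proof.
split; first split.
- by apply/asboolP; exists 0; rewrite scale0r.
- move=> _ _ /asboolP[a ->] /asboolP[b ->]; apply/asboolP.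
  by exists (a + b); rewrite scalerDl.
- move=> a _ /asboolP[b ->]; apply/asboolP.
  by exists (a * b); rewrite scalerA.
Qed.

HB.instance Definition _ {R : realType} {V : normedModType R} (v : V) :=
  GRing.isSubmodClosed.Build R V (line v) (line_submod v).

Lemma lineP {R : realType} {V : normedModType R} (v x : V) :
  x \in line v <-> exists a : R, x = a *: v.
Proof. by split=> [/asboolP|xv]; last exact/asboolP. Qed.

(** Inside the open ball [v] is the midpoint of [v + u] and [v - u] with [|u| = 1 - |v|]. The vector
    [w] gives [u] a direction and rules out the zero space, whose ball has 0 as extreme point. *)
Lemma extreme_unit_sphere {R : realType} {V : normedModType R} (v w : V) :
  w != 0 -> extreme_points unit_ball v -> unit_sphere v.
Proof.
move=> w0 [v1 vext]; have half : 0 < (1 / 2 : R) < 1 by lra.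
have nw : 0 < `|w| by rewrite normr_gt0.
apply/eqP; rewrite eq_le [X in X && _]v1/= leNgt; apply/negP => vlt1.
pose u := ((1 - `|v|) / `|w|) *: w.
have un : `|u| = 1 - `|v|.
  rewrite normrZ normrM normfV normr_id ger0_norm; last by lra.
  by rewrite divfK// gt_eqF.
have [||||vu _] := vext (v + u) (v - u) (1 / 2).
- by rewrite /unit_ball/= (le_trans (ler_normD _ _))// un; lra.
- by rewrite /unit_ball/= (le_trans (ler_normB _ _))// un; lra.
- by [].
- rewrite (_ : 1 - 1 / 2 = 1 / 2); last by lra.
  rewrite -scalerDr addrACA subrr addr0 scalerDr -scalerDl.
  by rewrite (_ : 1 / 2 + 1 / 2 = 1) ?scale1r//; lra.
move: un; have -> : u = 0 by apply: (addrI v); rewrite vu addr0.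
by rewrite normr0; lra.
Qed.

Theorem corollary6p10 (R : realType) (L : topologicalType)
    (L_nonempty : [set: L] !=set0)
    (L_locally_compact : locally_compact [set: L])
    (L_hausdorff : hausdorff_space L) :
  let X : normedModType R := C0 R L in
  [<->
    (* a *) ~ (exists x : L, isolated [set: L] x);
    (* b *) ~ (exists2 f : dual X,
                extreme_points unit_ball f & point_of_continuity f);
    (* c *) ~ (exists2 f : dual X, unit_sphere f & point_of_continuity f);
    (* d *) ~ (exists J : submodClosed X,
                [/\ nonzero_subspace J, M_ideal J
                  & weakly_hahn_banach_smooth (sub_normed J)]);
    (* e *) ~ (exists2 Y : submodClosed X,
                nonzero_subspace Y & property_wU (in_bidual Y));
    (* f *) ~ (exists2 Y : submodClosed X,
                one_dimensional Y & property_wU (in_bidual Y))].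
Proof.
move=> X.
have atom x : isolated [set: L] x -> exists e : X, M_line e (delta R x).
  exact: isolated_M_line.
have ac : ~ (exists x : L, isolated [set: L] x) ->
    ~ (exists2 f : dual X, unit_sphere f & point_of_continuity f).
  move=> /forallNP niso [f f1]; exact: sphere_not_continuity.
(* Each of (b), (c), (d), (f) excludes isolated points by the [M_line] at such a point, and without
   isolated points the next statement of the cycle holds. From (e) to (f) it is enough that lines
   are nonzero. *)
tfae.
- move=> /ac nc [f fext fc]; apply: nc; exists f => //.
  (* A point of [L] provides a nonzero functional, so extreme points have norm 1. *)
  have [x _] := L_nonempty.
  apply: (extreme_unit_sphere f (delta R x)) fext.
  have [p [px _ _]] :=
    @C0_bump R L x setT L_locally_compact L_hausdorff filterT.
  apply/eqP => dx0; have := deltaE x p; rewrite dx0 px => /eqP.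
  by rewrite eq_sym oner_eq0.
- move=> nb; apply: ac => -[x /atom[e Me]]; apply: nb.
  exists (delta R x); last exact: M_line_continuity Me.
  exact: delta_extreme.
- move=> nc [J [J0 MJ]]; apply: M_ideal_not_smooth => // x /atom[e Me].
  apply: nc; exists (delta R x); last exact: M_line_continuity Me.
  exact: M_line_dual_norm Me.
- move=> nd [Y Y0]; apply: subspace_not_wU => // x /atom[e Me].
  apply: nd; exists (line e : submodClosed X); split.
  + exists e; first by apply/lineP; exists 1; rewrite scale1r.
    by rewrite -normr_gt0 (M_line_norm Me).
  + apply: (M_line_M_ideal (line e) (line (delta R x)) Me) => z; exact: lineP.
  + by apply: (M_line_smooth (line e) Me) => z; exact: lineP.
- move=> ne [Y [v v0 Yv] wY]; apply: ne; exists Y => //; exists v => //.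
  by apply/Yv; exists 1; rewrite scale1r.
- move=> nf [x /atom[e Me]]; apply: nf; exists (line e : submodClosed X).
    exists e; first by rewrite -normr_gt0 (M_line_norm Me).
    exact: lineP.
  by apply: (M_line_wU_bidual (line e) Me) => z; exact: lineP.
Qed.
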